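(* Let $\beta>\beta_c$. The two-overlap distribution converges in law, as $N\to\infty$, to a sum of two delta masses: $$\mathbb{E}\,G_{\beta,N}^{\times2}\{R_N(\sigma,\sigma')\in\cdot\,\}\ \longrightarrow\ \frac{\beta_c}{\beta}\,\delta_q+\Big(1-\frac{\beta_c}{\beta}\Big)\delta_1,$$ where $q=\mathbb{E}[\tanh^2\beta_ch_1]$.
   Context: For $N\in\mathbb{N}$ let $\Sigma_N=\{-1,+1\}^N$. On a probability space $(\Omega,\mathcal{F},\mathbb{P})$ with expectation $\mathbb{E}$ are defined: for each $N$, a family $X_N=(X_N(\sigma),\sigma\in\Sigma_N)$ of i.i.d. centered Gaussian random variables of variance $N$; and a sequence $\vec h=(h_i,i\in\mathbb{N})$ of i.i.d. real random variables independent of the $X_N$'s, with $\mathbb{E}[\exp(t h_1)]<\infty$ for all $t\in\mathbb{R}$. The Hamiltonian is $$H_N(\sigma)=X_N(\sigma)+Y_N(\sigma),\qquad Y_N(\sigma)=\sum_{i=1}^N h_i\sigma_i,\qquad \sigma\in\Sigma_N.$$ The number $\beta_c$ is given by the self-consistency equation $$\beta_c=\sqrt{2\Big(\log 2-\big(\beta_c\,\mathbb{E}[h_1\tanh \beta_c h_1]-\mathbb{E}[\log\cosh\beta_c h_1]\big)\Big)}.$$ The Gibbs measure is $G_{\beta,N}(\sigma)=e^{\beta H_N(\sigma)}/Z_N(\beta)$ with $Z_N(\beta)=\sum_{\sigma\in\Sigma_N}e^{\beta H_N(\sigma)}$, and $G_{\beta,N}^{\times2}$ is its product measure on $\Sigma_N\times\Sigma_N$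 (two independent samples $\sigma,\sigma'$ given the same $X_N,\vec h$). The overlap is $R_N(\sigma,\sigma')=\frac1N\sum_{i=1}^N\sigma_i\sigma_i'$. Convergence in law means weak convergence of probability measures on $[-1,1]$. *)

(* Defs.v *)
From HB Require Import structures.
From mathcomp Require Import all_boot all_order all_algebra.
From mathcomp Require Import all_classical all_reals all_analysis.
From mathcomp Require Import measurable_realfun.

Set Implicit Arguments.
Unset Strict Implicit.
Unset Printing Implicit Defensive.

Import Order.TTheory GRing.Theory Num.Theory.
Import numFieldNormedType.Exports.

Local Open Scope classical_set_scope.
Local Open Scope ring_scope.

Definition cosh (R : realType) (x : R) : R := (expR x + expR (- x)) / 2.
Definition sinh (R : realType) (x : R) : R := (expR x - expR (- x)) / 2.
Definition tanh (R : realType) (x : R) : R := sinh x / cosh x.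

Definition mutually_independent d (T : measurableType d) (R : realType)
    (P : probability T R) (I : choiceType) (Y : I -> T -> R) : Prop :=
  forall (s : seq I) (B : I -> set R), uniq s -> (forall i, measurable (B i)) ->
    P (\bigcap_(i in [set` s]) (Y i @^-1` B i)) =
    (\prod_(i <- s) P (Y i @^-1` B i))%E.

(* sigma(Y_i, i in D) *)
Definition sigma_family (T I : Type) (R : realType) (D : set I)
    (Y : I -> T -> R) : set (set T) :=
  <<s \bigcup_(i in D) preimage_set_system setT (Y i) measurable >>.

Definition independent_families d (T : measurableType d) (R : realType)
    (P : probability T R) (I J : Type) (D : set I) (Y : I -> T -> R)
    (E : set J) (Z : J -> T -> R) : Prop :=
  forall A B, sigma_family D Y A -> sigma_family E Z B ->
    P (A `&` B) = (P A * P B)%E.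

(* Weak convergence of probability measures carried by D: the test functions
   are the bounded continuous functions on the subspace D. *)
Definition weak_cvg_on (R : realType) (D : set R)
    (mu_ : nat -> probability (measurableTypeR R) R)
    (mu : probability (measurableTypeR R) R) : Prop :=
  forall f : R -> R, {within D, continuous f} ->
    (exists M, forall x, D x -> `|f x| <= M) ->
    (fun n => \int[mu_ n]_(x in D) (f x)%:E)%E @ \oo -->
      (\int[mu]_(x in D) (f x)%:E)%E.

(* {-1,+1}^N, where true encodes +1 and false encodes -1 *)
Notation configuration N := {ffun 'I_N -> bool}.

Section random_energy_model.
Context (R : realType).

Definition spin N (s : configuration N) (i : 'I_N) : R :=
  if s i then 1 else -1.

Definition overlap N (s s' : configuration N) : R :=
  N%:R^-1 * \sum_(i < N) spin s i * spin s' i.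

Context d (Omega : measurableType d) (P : probability Omega R).
(* h is indexed from 0: Y_N(s) involves h 0, ..., h N.-1 *)
Variables (X : forall N, configuration N -> {RV P >-> R})
          (h : nat -> {RV P >-> R}).

Definition hamiltonian N (w : Omega) (s : configuration N) : R :=
  X s w + \sum_(i < N) h i w * spin s i.

Definition partition_function (beta : R) N (w : Omega) : R :=
  \sum_(s : configuration N) expR (beta * hamiltonian w s).

Definition gibbs (beta : R) N (w : Omega) (s : configuration N) : R :=
  expR (beta * hamiltonian w s) / partition_function beta N w.

Definition gibbs2 (beta : R) N (w : Omega)
    (E : {pred configuration N * configuration N}) : R :=
  \sum_(p in E) gibbs beta w p.1 * gibbs beta w p.2.

Definition overlap_law (beta : R) N : set (measurableTypeR R) -> \bar R :=
  fun A => 'E_P[fun w =>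
    gibbs2 beta w [pred p : configuration N * configuration N |
                     overlap p.1 p.2 \in A]]%E.

Lemma partition_function_gt0 beta N w : 0 < partition_function beta N w.
Proof.
rewrite /partition_function (bigD1 [ffun=> true])//= ltr_pwDl ?expR_gt0//.
by apply: sumr_ge0 => s _; exact: expR_ge0.
Qed.

Lemma gibbs_ge0 beta N w (s : configuration N) : 0 <= gibbs beta w s.
Proof. by rewrite divr_ge0 ?expR_ge0// ltW// partition_function_gt0. Qed.

Lemma sum_gibbs beta N w : \sum_(s : configuration N) gibbs beta w s = 1.
Proof. by rewrite -mulr_suml divff// gt_eqF// partition_function_gt0. Qed.

Lemma gibbs_le1 beta N w (s : configuration N) : gibbs beta w s <= 1.
Proof.
rewrite -(sum_gibbs beta N w) (bigD1 s)//= lerDl.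
by apply: sumr_ge0 => s' _; exact: gibbs_ge0.
Qed.

Lemma measurable_weight beta N (s : configuration N) :
  measurable_fun setT (fun w => expR (beta * hamiltonian w s)).
Proof.
apply: measurableT_comp => //; apply: measurable_funM => //.
apply: measurable_funD => //; apply: measurable_sum => i.
exact: measurable_funM.
Qed.

Lemma measurable_gibbs beta N (s : configuration N) :
  measurable_fun setT (fun w => gibbs beta w s).
Proof.
have -> : (fun w => gibbs beta w s) = (fun w =>
    expR (beta * hamiltonian w s - ln (partition_function beta N w))).
  apply/funext => w.
  by rewrite expRD expRN lnK// posrE partition_function_gt0.
apply: measurableT_comp => //; apply: measurable_funB.
  apply: measurable_funM => //; apply: measurable_funD => //.
  by apply: measurable_sum => i; exact: measurable_funM.
apply: measurableT_comp => //.
by apply: measurable_sum => s'; exact: measurable_weight.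
Qed.

Definition gibbs2_mean beta N (p : configuration N * configuration N) : \bar R :=
  (\int[P]_w (gibbs beta w p.1 * gibbs beta w p.2)%:E)%E.

Lemma gibbs2_mean_ge0 beta N (p : configuration N * configuration N) :
  (0 <= gibbs2_mean beta p)%E.
Proof. by apply: integral_ge0 => w _; rewrite lee_fin mulr_ge0 ?gibbs_ge0. Qed.

Lemma gibbs2_mean_fin_num beta N (p : configuration N * configuration N) :
  gibbs2_mean beta p \is a fin_num.
Proof.
rewrite ge0_fin_numE ?gibbs2_mean_ge0//; apply: (@le_lt_trans _ _ (\int[P]_w 1%:E)%E).
  apply: ge0_le_integral => //.
  - by move=> w _; rewrite lee_fin mulr_ge0 ?gibbs_ge0.
  - by apply/measurable_EFinP; apply: measurable_funM; exact: measurable_gibbs.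
  - by move=> w _; rewrite lee_fin mulr_ile1 ?gibbs_ge0 ?gibbs_le1.
by rewrite integral_cst//= mul1e probability_setT ltry.
Qed.

Lemma overlap_lawE beta N A : overlap_law beta N A =
  (\sum_(p : configuration N * configuration N)
     gibbs2_mean beta p * \d_(overlap p.1 p.2) A)%E.
Proof.
rewrite /overlap_law unlock /gibbs2.
transitivity (\int[P]_w (\sum_(p : configuration N * configuration N)
    \d_(overlap p.1 p.2) A * (gibbs beta w p.1 * gibbs beta w p.2)%:E))%E.
  apply: eq_integral => w _; rewrite -sumEFin big_mkcond/=.
  apply: eq_bigr => p _; rewrite diracE inE.
  by case: (_ \in A); rewrite ?mul1e ?mul0e.
have mG (p : configuration N * configuration N) :
    measurable_fun setT (fun w => (gibbs beta w p.1 * gibbs beta w p.2)%:E).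
  by apply/measurable_EFinP; apply: measurable_funM; exact: measurable_gibbs.
have G0 (p : configuration N * configuration N) w :
    (0 <= (gibbs beta w p.1 * gibbs beta w p.2)%:E)%E.
  by rewrite lee_fin mulr_ge0 ?gibbs_ge0.
rewrite ge0_integral_sum//.
- by apply: eq_bigr => p _; rewrite ge0_integralZl// muleC.
- by move=> p; apply: emeasurable_funM.
- by move=> p w _; rewrite mule_ge0 ?gibbs2_mean_ge0.
Qed.

Let overlap_law0 beta N : overlap_law beta N set0 = 0%E.
Proof. by rewrite overlap_lawE big1// => p _; rewrite measure0 mule0. Qed.

Let overlap_law_ge0 beta N A : (0 <= overlap_law beta N A)%E.
Proof.
by rewrite overlap_lawE sume_ge0// => p _; rewrite mule_ge0 ?gibbs2_mean_ge0.
Qed.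

Let overlap_law_sigma_additive beta N :
  semi_sigma_additive (overlap_law beta N).
Proof.
move=> F mF tF mUF; rewrite [X in _ --> X](_ : _ =
    lim ((fun n => \sum_(0 <= i < n) overlap_law beta N (F i))%E @ \oo)).
  by apply: is_cvg_ereal_nneg_natsum => k _.
under eq_eseriesr do rewrite overlap_lawE.
rewrite nneseries_sum//; last by move=> *; rewrite mule_ge0 ?gibbs2_mean_ge0.
rewrite overlap_lawE; apply: eq_bigr => p _.
rewrite -(fineK (gibbs2_mean_fin_num beta p)) nneseriesZl//.
by rewrite measure_semi_bigcup.
Qed.

HB.instance Definition _ beta N :=
  isMeasure.Build _ (measurableTypeR R) R (overlap_law beta N)
    (overlap_law0 beta N) (overlap_law_ge0 beta N)
    (@overlap_law_sigma_additive beta N).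

Lemma overlap_law_carried beta N (D : set R) :
  (forall s s' : configuration N, D (overlap s s')) -> overlap_law beta N D = 1%E.
Proof.
move=> DR; rewrite /overlap_law unlock /gibbs2.
under eq_integral => w _.
  rewrite (eq_bigl xpredT); last by move=> p; rewrite !inE; apply/mem_set/DR.
  rewrite -(pair_bigA _ (fun s s' : configuration N =>
    gibbs beta w s * gibbs beta w s'))/=.
  under eq_bigr do rewrite -mulr_sumr sum_gibbs mulr1.
  rewrite sum_gibbs; over.
by rewrite integral_cst//= mul1e probability_setT.
Qed.

HB.instance Definition _ beta N :=
  Measure_isProbability.Build _ (measurableTypeR R) R (overlap_law beta N)
    (overlap_law_carried beta (fun _ _ => I)).

Lemma overlap_itv N (s s' : configuration N) : overlap s s' \in `[-1, 1].
Proof.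
have spin2 : `|\sum_(i < N) spin s i * spin s' i| <= N%:R.
  rewrite (le_trans (ler_norm_sum _ _ _))//.
  rewrite (le_trans (y := \sum_(i < N) 1))//; last by rewrite sumr_const card_ord.
  apply: ler_sum => i _.
  by rewrite /spin; case: (s i); case: (s' i);
     rewrite ?mulrNN ?mulr1 ?mul1r ?normrN normr1.
rewrite in_itv/= -ler_norml /overlap normrM ger0_norm ?invr_ge0//.
have [N0|N0] := posnP N.
  by rewrite [X in X * _](_ : _ = 0) ?mul0r// N0 invr0.
by rewrite ler_pdivrMl ?ltr0n// mulr1.
Qed.

Lemma overlap_law_itv beta N : overlap_law beta N `[-1, 1] = 1%E.
Proof. by apply: overlap_law_carried => s s'; exact: overlap_itv. Qed.

End random_energy_model.

(* Main.v *)
Require Import Defs.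
From HB Require Import structures.
From mathcomp Require Import all_boot all_order all_algebra.
From mathcomp Require Import all_classical all_reals all_analysis.
From mathcomp Require Import ring lra measurable_realfun.

(** Write [t] for [beta_c], [lam = E ln cosh (t h)], [a = E h tanh (t h)], and
    [H = X + Y] for the Hamiltonian, with [Y] the contribution of the random
    field.  The equation that defines [t] says [t^2/2 = ln 2 + lam - t a].

    Ground state.  The right-hand side is the entropy density of the
    configurations with [Y] close to [N a]: under the product law with weights
    proportional to [e^(t Y)] the mean of [Y] is close to [N a]
    ([card_high_energy]).  The left-hand side is the price, on the exponential
    scale, of a Gaussian energy [N t].  As the two agree, among the [e^(N t^2/2)]
    configurations of field energy [N a] some have Gaussian energy close to
    [N t], and [max H >= N (t + a - eta)] with probability tending to one
    ([ground_state]).  This single lower bound is used for both parts of the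
    limit law.

    Two distinct samples.  A Gibbs weight is at most one and [t < beta], so it is
    at most [e^(t (H(s) - M))] for every [M <= max H]; take [M] close to
    [N (t + a)].  For [s <> s'] the Gaussian energies are independent, so the
    expectation replaces each [e^(t X)] by [e^(t^2 N/2)], and by the equation for
    [t] what remains is [e^(o(N))] times the product law with weights
    proportional to [e^(t Y)], for two independent samples.  Under that law the
    overlap is an average of independent signs of means [tanh^2 (t h_i)], hence
    exponentially concentrated at [q] ([overlap_tail], [off_diagonal_overlap]).

    Two equal samples.  Gaussian integration by parts gives
    [E <X> = beta N (1 - E G^2 (s = s'))] ([gaussian_energy_ibp]), so the mass of
    the diagonal follows from [E <X> / N --> t] ([gaussian_energy_density]).  Let
    [Z(x)] be the partition function with [x X] added to the exponent.  By
    convexity [x <X> <= ln Z(x) - ln Z(0)].  The ground state bounds [ln Z(0)]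
    from below; with [m = t / beta], the inequality
    [(sum_i z_i)^m <= sum_i z_i^m] and a first moment bound [ln Z(x)] from above;
    to first order in [x] the two bounds differ by [N t x].  Small [x] of both
    signs give the limit.

    So the pairs [s = s'], where the overlap is one, carry a mass tending to
    [1 - t / beta], and the remaining mass accumulates at [q]. *)

Set Implicit Arguments.
Unset Strict Implicit.
Unset Printing Implicit Defensive.

Import Order.TTheory GRing.Theory Num.Theory.
Import numFieldNormedType.Exports.

Local Open Scope classical_set_scope.
Local Open Scope ring_scope.

(** * Hyperbolic functions and elementary bounds *)

Section hyperbolic.
Context {R : realType}.
Implicit Types x y : R.

Lemma cosh_ge1 x : 1 <= cosh x.
Proof.
rewrite /cosh ler_pdivlMr// mul1r.
by have := expR_ge1Dx x; have := expR_ge1Dx (- x); lra.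
Qed.

Lemma cosh_gt0 x : 0 < cosh x.
Proof. exact: lt_le_trans (cosh_ge1 x). Qed.

Lemma cosh_le x : cosh x <= expR `|x|.
Proof.
rewrite /cosh ler_pdivrMr//.
have h1 : expR x <= expR `|x| by rewrite ler_expR ler_norm.
have h2 : expR (- x) <= expR `|x| by rewrite ler_expR -normrN ler_norm.
lra.
Qed.

Lemma ln_cosh_ge0 x : 0 <= ln (cosh x).
Proof. by rewrite ln_ge0// cosh_ge1. Qed.

Lemma ln_cosh_le x : ln (cosh x) <= `|x|.
Proof. by rewrite -[leRHS]expRK ler_ln ?posrE ?cosh_gt0 ?expR_gt0// cosh_le. Qed.

Lemma tanh_le1 x : `|tanh x| <= 1.
Proof.
rewrite /tanh normrM normfV (gtr0_norm (cosh_gt0 x)) ler_pdivrMr ?cosh_gt0//.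
rewrite mul1r ler_norml /cosh /sinh.
by have := expR_gt0 x; have := expR_gt0 (- x); lra.
Qed.

Lemma tanh_sqr_le1 x : tanh x ^+ 2 <= 1.
Proof. by rewrite -(real_normK (num_real _)) expr_le1 ?tanh_le1. Qed.

Lemma tanh_ge0 x : 0 <= x -> 0 <= tanh x.
Proof.
move=> x0; rewrite /tanh divr_ge0 ?(ltW (cosh_gt0 _))// /sinh divr_ge0// subr_ge0
  ler_expR; lra.
Qed.

Lemma tanhN x : tanh (- x) = - tanh x.
Proof. by rewrite /tanh /sinh /cosh opprK [in _ + expR x]addrC; field;
  rewrite gt_eqF// addr_gt0 ?expR_gt0. Qed.

Lemma mulr_tanh_ge0 t x : 0 <= t -> 0 <= x * tanh (t * x).
Proof.
move=> t0; have [x0|x0] := leP 0 x; first by rewrite mulr_ge0// tanh_ge0// mulr_ge0.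
by rewrite -mulrNN -tanhN -mulrN mulr_ge0// ?tanh_ge0// ?mulr_ge0//; lra.
Qed.

(** The second-order bound with constant 2 follows from [1 - x <= expR (- x)];
    the room between 1/2 and 2 is what makes it hold up to [x = 1/2]. *)
Lemma expR_le_quad x : x <= 1 / 2 -> expR x <= 1 + x + 2 * x ^+ 2.
Proof.
move=> x1; have e0 := expR_gt0 x.
have := expR_ge1Dx (- x); rewrite expRN => h.
have {}h : (1 - x) * expR x <= 1 by rewrite -ler_pdivlMr// div1r.
have q : 1 <= (1 - x) * (1 + x + 2 * x ^+ 2).
  have := sqr_ge0 x; nra.
by rewrite -(@ler_pM2l _ (1 - x)) ?(le_trans h q)//; lra.
Qed.

Lemma sqr_le_expR x : x ^+ 2 <= 2 * (expR x + expR (- x)).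
Proof.
have key (z : R) : 0 <= z -> z ^+ 2 <= 2 * (expR z + expR (- z)).
  move=> z0; have := @expR_ge1Dxn R z 1 z0; rewrite !factS fact0 !muln1.
  by have := expR_gt0 (- z); lra.
have [x0|x0] := leP 0 x; first exact: key.
by rewrite -sqrrN -[X in expR X + _]opprK [expR _ + _]addrC key// oppr_ge0 ltW.
Qed.

End hyperbolic.

(** * The exponentially tilted product law on spin configurations *)

Section tilted_law.
Context {R : realType} (N : nat).
Implicit Types (y c h : 'I_N -> R) (s : configuration N).

(** The law under which the spins are independent and [s i] has mean
    [tanh (y i)]. *)
Definition tilted_weight y s : R :=
  \prod_(i < N) (expR (y i * spin R s i) / (2 * cosh (y i))).

Lemma tilted_weight_gt0 y s : 0 < tilted_weight y s.
Proof.
rewrite /tilted_weight; apply: prodr_gt0 => i _.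
by rewrite divr_gt0 ?expR_gt0// mulr_gt0 ?cosh_gt0.
Qed.

Lemma tilted_weightE y s : tilted_weight y s =
  expR (\sum_(i < N) y i * spin R s i) / \prod_(i < N) (2 * cosh (y i)).
Proof. by rewrite expR_sum -prodfV -big_split. Qed.

(** Exhibits the law as the Gibbs law of the field, with its log-partition
    function. *)
Lemma tilted_weight_expR y s : tilted_weight y s =
  expR (\sum_(i < N) y i * spin R s i - (N%:R * ln 2 + \sum_(i < N) ln (cosh (y i)))).
Proof.
rewrite tilted_weightE expRB; congr (_ / _).
rewrite expRD expR_sum expRM_natl lnK ?posrE// big_split/= prodr_const card_ord.
by congr (_ * _); apply: eq_bigr => i _; rewrite lnK// posrE cosh_gt0.
Qed.

(** Product observables have product expectations: everything below about the
    tilted law (mass, covariances, exponential moments) is an instance. *)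
Lemma tilted_prod y (u : 'I_N -> bool -> R) :
  \sum_(s : configuration N) tilted_weight y s * \prod_(i < N) u i (s i) =
  \prod_(i < N) ((1 + tanh (y i)) / 2 * u i true + (1 - tanh (y i)) / 2 * u i false).
Proof.
pose F i b := expR (y i * (if b then 1 else -1)) / (2 * cosh (y i)) * u i b.
transitivity (\sum_(s : configuration N) \prod_(i < N) F i (s i)).
  by apply: eq_bigr => s _; rewrite -big_split.
rewrite -bigA_distr_bigA; apply: eq_bigr => i _.
rewrite big_bool /F mulr1 mulrN1 /tanh.
have : expR (y i) + expR (- y i) != 0 by rewrite gt_eqF// addr_gt0 ?expR_gt0.
by rewrite /sinh /cosh => e0; congr (_ * _ + _ * _); field.
Qed.

Lemma sum_tilted_weight y : \sum_(s : configuration N) tilted_weight y s = 1.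
Proof.
transitivity (\sum_(s : configuration N) tilted_weight y s * \prod_(i < N)
  (fun _ _ => 1) i (s i)).
  by apply: eq_bigr => s _; rewrite big1// mulr1.
by rewrite (tilted_prod y (fun _ _ => 1)) big1// => i _; field.
Qed.

Lemma tilted_weight_le1 y s : tilted_weight y s <= 1.
Proof.
rewrite -(sum_tilted_weight y) (bigD1 s)//= lerDl.
by apply: sumr_ge0 => s' _; exact/ltW/tilted_weight_gt0.
Qed.

Lemma tilted_variance y c :
  \sum_(s : configuration N) tilted_weight y s *
    (\sum_(i < N) c i * (spin R s i - tanh (y i))) ^+ 2
  <= \sum_(i < N) c i ^+ 2.
Proof.
pose e i b : R := (if b then 1 else -1) - tanh (y i).
have cov i j : \sum_(s : configuration N) tilted_weight y s * (e i (s i) * e j (s j)) =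
    if i == j then 1 - tanh (y i) ^+ 2 else 0.
  (* both factors fall on the same site when [i = j] *)
  pose u k b := (if k == i then e i b else 1) * (if k == j then e j b else 1).
  transitivity (\sum_(s : configuration N) tilted_weight y s * \prod_(k < N) u k (s k)).
    apply: eq_bigr => s _; congr (_ * _); rewrite big_split/=; congr (_ * _).
      by rewrite -big_mkcond/= big_pred1_eq.
    by rewrite -big_mkcond/= big_pred1_eq.
  rewrite (tilted_prod y u) (bigD1 i)//= /u eqxx.
  have [<-|ij] := eqVneq i j.
    rewrite big1 ?mulr1 => [|k ki]; first by rewrite /e; field.
    by rewrite (negbTE ki) !mulr1; field.
  by rewrite [X in X * _](_ : _ = 0) ?mul0r// /e; field.
under eq_bigr do rewrite expr2 big_distrlr mulr_sumr.
rewrite exchange_big/= ler_sum// => i _.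
rewrite (_ : \sum_(s : configuration N) _ = \sum_j c i * c j *
  \sum_(s : configuration N) tilted_weight y s * (e i (s i) * e j (s j))).
  rewrite (bigD1 i)//= [X in _ + X]big1 => [|j ji];
    last by rewrite cov eq_sym (negbTE ji) mulr0.
  rewrite cov eqxx addr0; have := sqr_ge0 (tanh (y i)); have := sqr_ge0 (c i); nra.
under eq_bigr do rewrite mulr_sumr.
rewrite exchange_big/=; apply: eq_bigr => j _; rewrite mulr_sumr.
by apply: eq_bigr => s _; rewrite /e /spin; ring.
Qed.

(** Entropy lower bound.  By Chebyshev's inequality the tilted law gives mass at
    least 1/2 to the configurations of field energy within [2 N dl] of [N a], and
    each of those has weight at most [e^(t N (a + 2 dl))] divided by the partition
    function, so there must be many of them. *)
Lemma card_high_energy h (t a lam dl : R) : (0 < N)%N -> 0 <= t -> 0 < dl ->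
  N%:R * (lam - dl) <= \sum_(i < N) ln (cosh (t * h i)) ->
  `|\sum_(i < N) h i * tanh (t * h i) - N%:R * a| <= N%:R * dl ->
  \sum_(i < N) h i ^+ 2 <= (N%:R * dl) ^+ 2 / 2 ->
  expR (N%:R * (ln 2 + lam - dl - t * (a + 2 * dl))) / 2 <=
  #|[pred s : configuration N |
      N%:R * (a - 2 * dl) <= \sum_(i < N) h i * spin R s i]|%:R.
Proof.
move=> N0 t0 dl0 hc ht h2; have N0R : 0 < N%:R :> R by rewrite ltr0n.
pose y i := t * h i.
pose Y s := \sum_(i < N) h i * spin R s i.
pose D s := \sum_(i < N) h i * (spin R s i - tanh (y i)).
have DE s : D s = Y s - \sum_(i < N) h i * tanh (t * h i).
  by rewrite /D -sumrB; apply: eq_bigr => i _; rewrite mulrBr.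
have Nd : 0 < N%:R * dl by rewrite mulr_gt0.
set A := [pred s | _].
have half : 1 / 2 <= \sum_(s | `|D s| <= N%:R * dl) tilted_weight y s.
  have : \sum_(s | ~~ (`|D s| <= N%:R * dl)) tilted_weight y s <= 1 / 2.
    rewrite -(@ler_pM2r _ ((N%:R * dl) ^+ 2)) ?exprn_gt0// mulr_suml.
    rewrite div1r [leRHS]mulrC; apply: le_trans h2; apply: le_trans (tilted_variance y h).
    rewrite big_mkcond/=; apply: ler_sum => s _; case: ifPn => [|_]; last first.
      by rewrite mulr_ge0 ?sqr_ge0 ?ltW ?tilted_weight_gt0.
    rewrite -ltNge => /ltW hD; rewrite ler_pM2l ?tilted_weight_gt0//.
    by rewrite -[leRHS](real_normK (num_real _)) lerXn2r// nnegrE ltW.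
  have := sum_tilted_weight y; rewrite (bigID (fun s => `|D s| <= N%:R * dl))/=.
  by lra.
set B := expR _.
have B0 : 0 < B by rewrite expR_gt0.
have wB s : `|D s| <= N%:R * dl -> tilted_weight y s <= B^-1.
  move=> Ds; rewrite tilted_weight_expR.
  have -> : \sum_(i < N) y i * spin R s i = t * Y s.
    by rewrite /Y mulr_sumr; apply: eq_bigr => i _; rewrite mulrA.
  rewrite -expRN ler_expR.
  have {Ds ht} : Y s <= N%:R * (a + 2 * dl).
    by move: Ds ht; rewrite DE !ler_norml; lra.
  move=> /(ler_wpM2l t0) tY.
  nra.
rewrite -(@ler_pM2l _ B^-1) ?invr_gt0// mulrA mulVf ?gt_eqF//.
rewrite -[X in X / 2]/(1 : R); apply: (le_trans half).
apply: (@le_trans _ _ (\sum_(s | `|D s| <= N%:R * dl) B^-1)); first exact: ler_sum.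
rewrite -big_filter.
apply: (@le_trans _ _ (\sum_(s in A) B^-1)); last by rewrite sumr_const mulr_natr.
rewrite big_filter [leLHS]big_mkcond [leRHS]big_mkcond ler_sum// => s _.
have [Ds|] := boolP (`|D s| <= _); last by case: ifP => // _ _; rewrite invr_ge0 ltW.
rewrite inE; case: ifPn => // /negP[].
by move: Ds ht; rewrite DE /Y !ler_norml; lra.
Qed.

(** Chernoff's bound.  Under two independent samples the products [s i * s' i] are
    independent signs of means [tanh (y i) ^+ 2], so the exponential moment of
    [N] times the overlap at [x] is at most
    [exp (x sum_i tanh (y i) ^+ 2 + 2 N x^2)]. *)
Lemma overlap_tail y (q eps dl la : R) : (0 < N)%N ->
  `|\sum_(i < N) tanh (y i) ^+ 2 - N%:R * q| <= N%:R * dl ->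
  0 <= la -> la <= 1 / 2 ->
  \sum_(p : configuration N * configuration N | eps < `|overlap R p.1 p.2 - q|)
    tilted_weight y p.1 * tilted_weight y p.2 <=
  2 * expR (N%:R * (2 * la ^+ 2 + la * dl - la * eps)).
Proof.
move=> N0 hq la0 la1; have N0R : 0 < N%:R :> R by rewrite ltr0n.
pose S (p : configuration N * configuration N) := \sum_(i < N) spin R p.1 i * spin R p.2 i.
pose W p := tilted_weight y p.1 * tilted_weight y p.2.
have mgf (x : R) : `|x| <= 1 / 2 -> \sum_p W p * expR (x * S p) <=
    expR (x * \sum_(i < N) tanh (y i) ^+ 2 + N%:R * (2 * x ^+ 2)).
  move=> x1.
  have -> : \sum_p W p * expR (x * S p) =
      \prod_(i < N) ((1 + tanh (y i) ^+ 2) / 2 * expR x + (1 - tanh (y i) ^+ 2) / 2 *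
        expR (- x)).
    rewrite -(pair_bigA _ (fun s s' => W (s, s') * expR (x * S (s, s'))))/=.
    transitivity (\sum_(s : configuration N) tilted_weight y s * \prod_(i < N)
       ((1 + tanh (y i)) / 2 * expR (x * spin R s i) +
        (1 - tanh (y i)) / 2 * expR (- (x * spin R s i)))).
      apply: eq_bigr => s _; rewrite /W/=; under eq_bigr do rewrite -mulrA.
      rewrite -mulr_sumr; congr (_ * _).
      transitivity (\sum_(s' : configuration N) tilted_weight y s' * \prod_(i < N)
          (fun i (b : bool) => expR (x * spin R s i * (if b then 1 else -1))) i (s' i)).
        apply: eq_bigr => s' _; congr (_ * _); rewrite /S mulr_sumr expR_sum.
        by apply: eq_bigr => i _; rewrite mulrA.
      rewrite (tilted_prod y (fun i b => expR (x * spin R s i * (if b then 1 else -1)))).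
      by apply: eq_bigr => i _; rewrite mulr1 mulrN1.
    rewrite (tilted_prod y (fun i b => (1 + tanh (y i)) / 2 * expR
      (x * (if b then 1 else -1)) +
        (1 - tanh (y i)) / 2 * expR (- (x * (if b then 1 else -1))))).
    by apply: eq_bigr => i _; rewrite !mulr1 !mulrN1 opprK; field.
  rewrite [leRHS](_ : _ = \prod_(i < N) expR (x * tanh (y i) ^+ 2 + 2 * x ^+ 2));
    last first.
    rewrite -expR_sum; congr expR; rewrite big_split/= -mulr_sumr sumr_const card_ord.
    by rewrite mulr_natl.
  apply: ler_prod => i _.
  have t1 := tanh_sqr_le1 (y i); have t0 := sqr_ge0 (tanh (y i)).
  rewrite addr_ge0 ?mulr_ge0 ?expR_ge0//=; try lra.
  apply: le_trans (expR_ge1Dx _).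
  have := @expR_le_quad _ x; have := @expR_le_quad _ (- x).
  move: x1; rewrite ler_norml => /andP[xl xu] /(_ ltac:(lra)) h1 /(_ xu) h2.
  move: h1; rewrite sqrrN => h1; nra.
have NR p : N%:R * overlap R p.1 p.2 = S p.
  by rewrite /overlap mulrA divff ?mul1r// gt_eqF.
apply: (@le_trans _ _ (\sum_p (W p * expR (la * S p) * expR (- (la * (N%:R * (q + eps)))) +
                         W p * expR (- la * S p) * expR (la * (N%:R * (q - eps)))))).
  rewrite big_mkcond/=; apply: ler_sum => p _.
  have W0 : 0 < W p by rewrite mulr_gt0 ?tilted_weight_gt0.
  case: ifPn => [|_]; last by rewrite addr_ge0// mulr_ge0 ?expR_ge0// mulr_ge0
    ?expR_ge0// ltW.
  rewrite -!(mulrA (W p)) -!expRD -mulrDr => far.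
  rewrite -[leLHS]mulr1 ler_pM2l//; move: far.
  rewrite lter_normr => /orP[hp|hp].
    rewrite -[leLHS]addr0 lerD ?expR_ge0// -[leLHS]expR0 ler_expR -NR.
    suff : 0 <= la * (N%:R * (overlap R p.1 p.2 - q - eps)) by lra.
    by rewrite !mulr_ge0// ?ltW//; lra.
  rewrite -[leLHS]add0r lerD ?expR_ge0// -[leLHS]expR0 ler_expR -NR.
  suff : 0 <= la * (N%:R * (- (overlap R p.1 p.2 - q) - eps)) by lra.
  by rewrite !mulr_ge0// ?ltW//; lra.
rewrite big_split/= -!mulr_suml.
have lan : `|la| <= 1 / 2 by rewrite ger0_norm.
have := mgf la lan; have := mgf (- la); rewrite normrN sqrrN => /(_ lan).
move=> hu hv.
apply: (@le_trans _ _ (expR (la * \sum_(i < N) tanh (y i) ^+ 2 + N%:R * (2 * la ^+ 2) -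
  la * (N%:R * (q + eps)))
   + expR (- la * \sum_(i < N) tanh (y i) ^+ 2 + N%:R * (2 * la ^+ 2) + la *
     (N%:R * (q - eps))))).
  by apply: lerD; rewrite [leRHS]expRD ler_pM2r ?expR_gt0.
set E := expR (N%:R * _).
rewrite (_ : 2 * E = E + E); last by rewrite mulr_natl mulr2n.
move: hq; rewrite ler_norml => /andP[hq1 hq2].
by apply: lerD; rewrite ler_expR; nra.
Qed.

End tilted_law.

(** * Gaussian integrals *)

Section gaussian.
Context {R : realType} (v : R) (v0 : 0 < v).
Notation mu := (@lebesgue_measure R).
Notation gamma := (normal_prob 0 (Num.sqrt v) : probability (measurableTypeR R) R).
Notation pdf := (normal_pdf 0 (Num.sqrt v)).

Let s0 : Num.sqrt v != 0. Proof. by rewrite gt_eqF// sqrtr_gt0. Qed.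

Let pdfE m x : normal_pdf m (Num.sqrt v) x =
  normal_peak (Num.sqrt v) * expR (- (x - m) ^+ 2 / (2 * v)).
Proof. by rewrite normal_pdfE// /normal_fun sqr_sqrtr ?ltW// mulr_natl. Qed.

(** Both the density and the Radon-Nikodym derivative integrate to the same
    measure, hence agree almost everywhere. *)
Lemma ge0_integral_normal (f : R -> R) : measurable_fun setT f ->
  (forall x, 0 <= f x) ->
  (\int[gamma]_x (f x)%:E = \int[mu]_x (f x * pdf x)%:E)%E.
Proof.
move=> mf f0.
have dom : gamma `<< mu by exact: normal_prob_dominates.
under [RHS]eq_integral do rewrite EFinM.
rewrite -(@Radon_Nikodym_SigmaFinite.change_of_variables _ _ _ gamma mu dom)//; last first.
  exact/measurable_EFinP.
apply: ge0_ae_eq_integral => //.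
- apply: emeasurable_funM; first exact/measurable_EFinP.
  by apply: (measurable_int mu); exact: Radon_Nikodym_SigmaFinite.f_integrable.
- apply: emeasurable_funM; first exact/measurable_EFinP.
  by apply/measurable_EFinP; exact: measurable_normal_pdf.
- move=> x _; apply: mule_ge0; first by rewrite lee_fin.
  exact: Radon_Nikodym_SigmaFinite.f_ge0.
- by move=> x _; rewrite -EFinM lee_fin mulr_ge0// normal_pdf_ge0.
apply: ae_eqe_mul2l.
apply: integral_ae_eq => //.
- exact: Radon_Nikodym_SigmaFinite.f_integrable.
- by apply/measurable_EFinP; exact: measurable_normal_pdf.
- by move=> E _ mE; rewrite -Radon_Nikodym_SigmaFinite.f_integral.
Qed.

(** Tilting the centred density by [e^(s x)] gives the density of mean [s v]. *)
Lemma normal_mgf (s : R) :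
  (\int[gamma]_x (expR (s * x))%:E = (expR (s ^+ 2 * v / 2))%:E)%E.
Proof.
rewrite ge0_integral_normal; last 2 first.
- by apply: measurableT_comp => //; exact: measurable_funM.
- by move=> x; exact: expR_ge0.
transitivity (\int[mu]_x ((expR (s ^+ 2 * v / 2))%:E *
  (normal_pdf (s * v) (Num.sqrt v) x)%:E))%E.
  apply: eq_integral => x _; rewrite -EFinM !pdfE; congr (_%:E).
  rewrite mulrCA -expRD [RHS]mulrCA -expRD; congr (_ * expR _).
  by field; rewrite gt_eqF.
rewrite integralZl//; last exact: integrable_normal_pdf.
by rewrite integral_normal_pdf mule1.
Qed.

(** Only the linear growth in the variance matters, so the square is compared
    with exponentials at scale [sqrt v]. *)
Lemma normal_second_moment_le :
  (\int[gamma]_x (x ^+ 2)%:E <= (4 * expR (1 / 2) * v)%:E)%E.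
Proof.
pose s := (Num.sqrt v)^-1.
have sv : s ^+ 2 * v = 1.
  by rewrite exprVn sqr_sqrtr ?ltW// mulVf// gt_eqF.
apply: (@le_trans _ _ (\int[gamma]_x
  ((2 * v)%:E * ((expR (s * x))%:E + (expR (- s * x))%:E)))%E).
  apply: ge0_le_integral => //.
  - by move=> x _; rewrite lee_fin sqr_ge0.
  - by apply/measurable_EFinP; exact: measurable_funX.
  - apply/measurable_EFinP; apply: measurable_funM => //.
    by apply: measurable_funD; apply: measurableT_comp => //; exact: measurable_funM.
  move=> x _; rewrite -EFinD -EFinM lee_fin.
  have -> : x ^+ 2 = v * (s * x) ^+ 2 by rewrite exprMn mulrA [v * _]mulrC sv mul1r.
  rewrite (mulrC 2) -mulrA ler_pM2l// mulNr; set y := s * x.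
  exact: sqr_le_expR.
rewrite ge0_integralZl; last 4 first.
- exact: measurableT.
- by apply: emeasurable_funD; apply/measurable_EFinP; apply: measurableT_comp => //;
  exact: measurable_funM.
- by move=> x _; rewrite lee_fin addr_ge0 ?expR_ge0.
- by rewrite lee_fin mulr_ge0 ?ltW.
rewrite ge0_integralD; last 5 first.
- exact: measurableT.
- by move=> x _; rewrite lee_fin ?expR_ge0.
- by apply/measurable_EFinP; apply: measurableT_comp => //; exact: measurable_funM.
- by move=> x _; rewrite lee_fin ?expR_ge0.
- by apply/measurable_EFinP; apply: measurableT_comp => //; exact: measurable_funM.
rewrite !normal_mgf sqrrN sv -EFinD -EFinM lee_fin; lra.
Qed.

(** The mass of [[b, b + 1]] alone already has the right exponential order. *)
Lemma normal_tail (b : R) : 0 <= b ->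
  ((normal_peak (Num.sqrt v) * expR (- (b + 1) ^+ 2 / (2 * v)))%:E <= gamma
    `[b, +oo[%classic)%E.
Proof.
move=> b0.
rewrite [leRHS](_ : _ = (\int[mu]_(x in `[b, +oo[) (pdf x)%:E)%E)//.
apply: (@le_trans _ _ (\int[mu]_(x in `[b, (b + 1)%R]) (pdf x)%:E)%E); last first.
  apply: ge0_subset_integral => //.
  - by apply: measurable_funTS; apply/measurable_EFinP; exact: measurable_normal_pdf.
  - by move=> x _; rewrite lee_fin normal_pdf_ge0.
  - by apply: subset_itvl; rewrite bnd_simp.
apply: (@le_trans _ _ (\int[mu]_(x in `[b, (b + 1)%R])
  (normal_peak (Num.sqrt v) * expR (- (b + 1) ^+ 2 / (2 * v)))%:E)%E).
  rewrite integral_cst//= lebesgue_measure_itv/= lte_fin ltrDl ltr01 -EFinB.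
  by rewrite (_ : b + 1 - b = 1) ?mule1//; ring.
apply: ge0_le_integral => //.
- by move=> x _; rewrite lee_fin mulr_ge0 ?expR_ge0 ?normal_peak_ge0.
- by apply: measurable_funTS; apply/measurable_EFinP; exact: measurable_normal_pdf.
move=> x /=; rewrite in_itv/= => /andP[bx xb]; rewrite lee_fin pdfE.
rewrite ler_wpM2l ?normal_peak_ge0// ler_expR subr0 ler_pM2r ?invr_gt0 ?mulr_gt0//.
by rewrite lerN2 lerXn2r// nnegrE; lra.
Qed.

Lemma normal_quadratic_integrable (f : R -> R) (C : R) : measurable_fun setT f ->
  (forall x, `|f x| <= C * (1 + x ^+ 2)) ->
  gamma.-integrable setT (EFin \o f).
Proof.
move=> mf fC.
have C0 : 0 <= C.
  by have := fC 0; rewrite expr0n/= addr0 mulr1; apply: le_trans.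
apply/integrableP; split; first exact/measurable_EFinP.
apply: (@le_lt_trans _ _ (\int[gamma]_x (C%:E * (1%:E + (x ^+ 2)%:E)))%E).
  apply: ge0_le_integral => //=.
  - by apply/measurable_EFinP; exact: measurableT_comp.
  - apply/measurable_EFinP; apply: measurable_funM => //.
    by apply: measurable_funD => //; exact: measurable_funX.
  - by move=> x _; rewrite -EFinD -EFinM lee_fin.
rewrite ge0_integralZl; last 4 first.
- exact: measurableT.
- apply/measurable_EFinP.
  by apply: measurable_funD => //; exact: measurable_funX.
- by move=> x _; rewrite lee_fin addr_ge0 ?sqr_ge0.
- by rewrite lee_fin.
rewrite ge0_integralD; last 5 first.
- exact: measurableT.
- by move=> x _; rewrite lee_fin.
- by apply/measurable_EFinP; exact: measurable_cst.
- by move=> x _; rewrite lee_fin sqr_ge0.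
- by apply/measurable_EFinP; exact: measurable_funX.
rewrite integral_cst// [X in (1%:E * X)%E](_ : _ = 1%E) ?mule1;
  last exact: probability_setT.
apply: (@le_lt_trans _ _ (C%:E * (1 + (4 * expR (1 / 2) * v)%:E))%E).
  by rewrite lee_wpmul2l// ?lee_fin// leeD2l// normal_second_moment_le.
by rewrite -EFinD -EFinM ltry.
Qed.

End gaussian.

Section integral_of_derivative.
Context {R : realType}.
Notation mu := (@lebesgue_measure R).

(** The fundamental theorem of calculus on [[- n, n]], and dominated convergence
    as [n] grows. *)
Lemma integral_derivative_eq0 (F f : R -> R) :
  continuous f -> mu.-integrable setT (EFin \o f) ->
  (forall x : R, is_derive x (1 : R) F (f x)) ->
  F n%:R @[n --> \oo] --> 0 -> F (- n%:R) @[n --> \oo] --> 0 ->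
  (\int[mu]_x (f x)%:E = 0)%E.
Proof.
move=> cf intf dF Fp Fm.
pose f_ n := (EFin \o f) \_ `[(- n%:R)%R : R, n%:R].
have intE n : (\int[mu]_x f_ n x = (F n%:R - F (- n%:R))%:E)%E.
  rewrite /f_ -integral_mkcond.
  have [->|n0] := posnP n.
    by rewrite oppr0 set_itv1 integral_set1 subrr.
  rewrite (@continuous_FTC2 _ f F) ?EFinB//.
  - by rewrite lterNl; have : (0 : R) < n%:R; [rewrite ltr0n|lra].
  - exact: continuous_subspaceT.
  - have cF : continuous F.
      by move=> x; apply: differentiable_continuous; apply/derivable1_diffP.
    split.
    + by move=> x _; exact: ex_derive.
    + apply: cvg_at_right_filter; exact: cF.
    + apply: cvg_at_left_filter; exact: cF.
  - by move=> x _; rewrite derive1E derive_val.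
have mf : measurable_fun setT f by exact: continuous_measurable_fun.
have cvgf (x : R) : f_ n x @[n --> \oo] --> (EFin \o f) x.
  apply: cvg_near_cst; near=> n; rewrite /f_ patchE mem_set//=.
  by rewrite in_itv/= -ler_norml; near: n; exact: nbhs_infty_ger.
have [|||||_ _ cvgI] := @dominated_convergence _ _ _ mu setT measurableT f_ (EFin \o f)
  (abse \o (EFin \o f)).
- move=> n; apply/(measurable_restrictT (EFin \o f)) => //.
  by apply: measurable_funTS; exact/measurable_EFinP.
- exact/measurable_EFinP.
- exact: aeW.
- exact: integrable_abse.
- apply: aeW => x n _; rewrite /f_ patchE; case: ifPn => //= _.
  by rewrite normr0 lee_fin.
have cvg0 : (\int[mu]_x f_ n x)%E @[n --> \oo] --> 0%E.
  under eq_fun do rewrite intE.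
  apply: cvg_EFin; first exact: nearW.
  by rewrite -[0](subrr 0); apply: cvgB.
by rewrite -(cvg_lim _ cvgI)// (cvg_lim _ cvg0).
Unshelve. all: by end_near. Qed.

End integral_of_derivative.

Section gaussian_ibp.
Context {R : realType} (v : R) (v0 : 0 < v).
Notation mu := (@lebesgue_measure R).
Notation gamma := (normal_prob 0 (Num.sqrt v) : probability (measurableTypeR R) R).
Notation pdf := (normal_pdf 0 (Num.sqrt v)).

Let s0 : Num.sqrt v != 0. Proof. by rewrite gt_eqF// sqrtr_gt0. Qed.

Let pdfE x : pdf x = normal_peak (Num.sqrt v) * expR (- (2 * v)^-1 * x ^+ 2).
Proof.
rewrite normal_pdfE// /normal_fun sqr_sqrtr ?ltW// subr0; congr (_ * expR _).
by rewrite -[v *+ 2]mulr_natl; ring.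
Qed.

Let pdf_derive (x : R) : is_derive x (1 : R) pdf (- (x / v) * pdf x).
Proof.
have -> : pdf = (fun y => normal_peak (Num.sqrt v) *: expR (- (2 * v)^-1 *: (y ^+ 2))).
  by apply/funext => y; rewrite pdfE.
have dsq : is_derive x (1 : R) (fun y : R => y ^+ 2) (2 * x).
  have := @is_deriveX R R id 2 x 1 1 _; rewrite expr1 => /(_ (is_derive_id _ _)) H.
  by apply: (is_derive_eq H); rewrite -[RHS]mulr1.
have H := is_derive1_comp (is_derive_expR _) (is_deriveZ (- (2 * v)^-1) dsq).
apply: (is_derive_eq (is_deriveZ (normal_peak (Num.sqrt v)) H)) => /=.
by rewrite /GRing.scale/=; field; rewrite gt_eqF.
Qed.

Let pdf_cvg0 (e : R) : `|e| = 1 -> pdf (e * n%:R) @[n --> \oo] --> 0.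
Proof.
move=> e1.
have : normal_peak (Num.sqrt v) * (expR (- (2 * v)^-1)) ^+ n @[n --> \oo] --> (0 : R).
  rewrite -(mulr0 (normal_peak (Num.sqrt v))); apply: cvgMr.
  by apply: cvg_expr; rewrite ger0_norm ?expR_ge0// expR_lt1 oppr_lt0 invr_gt0 mulr_gt0.
apply: (@squeeze_cvgr _ _ _ _ (fun=> 0)); last exact: cvg_cst.
apply: nearW => n; rewrite normal_pdf_ge0/= pdfE -expRM_natr.
rewrite ler_wpM2l ?normal_peak_ge0// ler_expR !mulNr lerN2.
rewrite ler_wpM2l ?invr_ge0 ?mulr_ge0 ?(ltW v0)//.
rewrite exprMn -(real_normK (num_real e)) e1 expr1n mul1r -natrX ler_nat.
by case: n => // n; rewrite leq_pmulr.
Qed.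

(** Stein's identity [E (x phi) = v E phi'], that is, the integral of the
    derivative of [- v phi pdf] vanishes.  It is stated with [x] split into its
    positive and negative parts so that both sides are integrals of nonnegative
    functions, to which Tonelli's theorem applies directly. *)
Lemma normal_ibp (phi phi' : R -> R) (C : R) :
  (forall x : R, is_derive x (1 : R) phi (phi' x)) -> continuous phi' ->
  (forall x, 0 <= phi x <= C) -> (forall x, 0 <= phi' x <= C) ->
  (\int[gamma]_x (Num.max x 0 * phi x)%:E =
   \int[gamma]_x (Num.max (- x) 0 * phi x + v * phi' x)%:E)%E.
Proof.
move=> dphi cphi' phiC phi'C.
have C0 : 0 <= C by have /andP[+ /(le_trans _)] := phiC 0; move=> /[swap] /[apply].
have cphi : continuous phi.
  by move=> x; apply: differentiable_continuous; apply/derivable1_diffP.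
have cpdf : continuous pdf by exact: continuous_normal_pdf.
pose A (x : R) := Num.max x 0 * phi x.
pose B (x : R) := Num.max (- x) 0 * phi x + v * phi' x.
have mA : measurable_fun setT A.
  apply: measurable_funM; first exact: measurable_maxr.
  exact: continuous_measurable_fun.
have mB : measurable_fun setT B.
  apply: measurable_funD.
    apply: measurable_funM; first by apply: measurable_maxr => //; exact: measurable_funN.
    exact: continuous_measurable_fun.
  by apply: measurable_funM => //; exact: continuous_measurable_fun.
have A0 x : 0 <= A x.
  by have /andP[? ?] := phiC x; rewrite mulr_ge0// le_max lexx orbT.
have B0 x : 0 <= B x.
  have /andP[? ?] := phiC x; have /andP[? ?] := phi'C x.
  by rewrite addr_ge0// mulr_ge0// ?le_max ?lexx ?orbT// ltW.
have maxle (x : R) : 0 <= Num.max x 0 <= 1 + x ^+ 2.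
  by rewrite le_max lexx orbT ge_max addr_ge0 ?sqr_ge0// andbT /=;
    have := sqr_ge0 (x - 1); nra.
have AC x : `|A x| <= (C + v * C) * (1 + x ^+ 2).
  rewrite ger0_norm// /A; have /andP[p0 pC] := phiC x; have /andP[m0 mx] := maxle x.
  apply: (@le_trans _ _ ((1 + x ^+ 2) * C)); first exact: ler_pM.
  rewrite mulrC ler_wpM2r ?addr_ge0 ?sqr_ge0//.
  by rewrite lerDl mulr_ge0// ltW.
have BC x : `|B x| <= (C + v * C) * (1 + x ^+ 2).
  rewrite ger0_norm// /B; have /andP[p0 pC] := phiC x; have /andP[m0 mx] := maxle (- x).
  have /andP[p'0 p'C] := phi'C x.
  rewrite mulrDl lerD//.
    by rewrite [leRHS]mulrC; apply: ler_pM => //; rewrite sqrrN in mx.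
  rewrite -mulrA ler_pM2l//; apply: le_trans p'C _.
  by rewrite ler_peMr// lerDl sqr_ge0.
have intg (g : R -> R) : measurable_fun setT g -> (forall x, 0 <= g x) ->
    (forall x, `|g x| <= (C + v * C) * (1 + x ^+ 2)) ->
    mu.-integrable setT (EFin \o (fun x => g x * pdf x)).
  move=> mg g0 gC; apply/integrableP; split.
    by apply/measurable_EFinP; apply: measurable_funM => //; exact: measurable_normal_pdf.
  under eq_integral do rewrite /= ger0_norm ?mulr_ge0 ?normal_pdf_ge0//.
  rewrite -ge0_integral_normal//.
  have /integrableP[_] := normal_quadratic_integrable v0 mg gC.
  by under eq_integral do rewrite /= ger0_norm//.
have iA := intg _ mA A0 AC; have iB := intg _ mB B0 BC.
rewrite !ge0_integral_normal//.
have lim0 (e : R) : `|e| = 1 -> - v *: (phi * pdf) (e * n%:R) @[n --> \oo] --> 0.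
  move=> e1; apply: (@squeeze_cvgr _ _ _ _ (fun n : nat => - (v * C) * pdf (e * n%:R))
      (fun n => v * C * pdf (e * n%:R))).
  - apply: nearW => n; rewrite mulNr -ler_norml /GRing.scale/= mulNr normrN.
    have /andP[p0 pC] := phiC (e * n%:R).
    rewrite ger0_norm; last by rewrite mulr_ge0 ?(ltW v0)//= mulr_ge0 ?normal_pdf_ge0.
    rewrite -mulrA ler_pM2l//=.
    by rewrite ler_wpM2r ?normal_pdf_ge0.
  - suff : - (v * C) * pdf (e * n%:R) @[n --> \oo] --> - (v * C) * 0 by rewrite mulr0.
    by apply: cvgMr; exact: pdf_cvg0.
  - suff : v * C * pdf (e * n%:R) @[n --> \oo] --> v * C * 0 by rewrite mulr0.
    by apply: cvgMr; exact: pdf_cvg0.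
pose f x := (x * phi x - v * phi' x) * pdf x.
have fE x : f x = A x * pdf x - B x * pdf x.
  rewrite /f /A /B -mulrBl; congr (_ * _); rewrite opprD addrA -mulrBl; congr (_ * _ - _).
  by have [x0|x0] := leP 0 x; [rewrite max_r ?subr0|rewrite max_l ?sub0r ?opprK]; lra.
have : (\int[mu]_x (f x)%:E = 0)%E.
  apply: (@integral_derivative_eq0 _ (fun x => - v *: (phi * pdf) x)).
  - move=> x; apply: cvgM; last exact: cpdf.
    apply: cvgB; apply: cvgM; [exact: cvg_id|exact: cphi|exact: cvg_cst|exact: cphi'].
  - have := integrableB measurableT iA iB; apply: eq_integrable => // x _ /=.
    by rewrite fE EFinB.
  - move=> x; apply: (is_derive_eq (is_deriveZ (- v) (is_deriveM (dphi x) (pdf_derive x)))).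
    by rewrite /GRing.scale/= /f; field; rewrite gt_eqF.
  - by have := lim0 1 (normr1 _); under eq_fun do rewrite mul1r.
  - by have := lim0 (-1) (normrN1 _); under eq_fun do rewrite mulN1r.
under eq_integral do rewrite fE EFinB.
rewrite integralB_EFin// => /eqP.
rewrite sube_eq ?add0e; last 2 first.
- exact: integrable_fin_num iA.
- by rewrite fin_num_adde_defr.
by move/eqP.
Qed.

End gaussian_ibp.

(** The real line carries two copies of the Borel structure, under different
    displays; distributions of random variables live on one and [normal_prob] on
    the other. *)
Lemma integral_borel_copy {R : realType} (m1 : {measure set R -> \bar R})
    (m2 : {measure set (measurableTypeR R) -> \bar R}) (f : R -> \bar R) :
  (forall A : set R, measurable A -> m1 A = m2 A) ->
  measurable_fun setT f -> (forall x, 0 <= f x)%E ->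
  (\int[m1]_x f x = \int[m2]_x f x)%E.
Proof.
move=> m12 mf f0.
have mid : measurable_fun [set: R] (fun x : R => (x : measurableTypeR R)).
  by move=> _ B mB; rewrite setTI.
transitivity (\int[pushforward m1 (fun x : R => (x : measurableTypeR R))]_x f x)%E.
  by rewrite (ge0_integral_pushforward mid).
apply: eq_measure_integral => A mA _.
by rewrite -m12.
Qed.

(** * Independence *)

Section independence.
Context {R : realType} d (T : measurableType d) (P : probability T R).

Lemma sub_generated_measurable (G : set (set T)) :
  G `<=` measurable -> <<s G >> `<=` (measurable : set (set T)).
Proof. by move=> GT; apply: smallest_sub => //; exact: sigma_algebra_measurable. Qed.

(** The sets independent of [B] form a Dynkin system. *)
Lemma indep_generated (G : set (set T)) (B : set T) :
  setI_closed G -> G `<=` measurable -> measurable B ->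
  (forall A, G A -> P (A `&` B) = (P A * P B)%E) ->
  forall A, <<s G >> A -> P (A `&` B) = (P A * P B)%E.
Proof.
move=> GI Gm mB GB.
have fB : P B \is a fin_num by exact: fin_num_measure.
apply: (@dynkin_induction _ (g_sigma_algebraType G) G) => //.
- by rewrite setTI probability_setT mul1e.
- move=> S mS PS.
  have mST : d.-measurable (S : set T) := sub_generated_measurable Gm mS.
  have fS : P S \is a fin_num by exact: fin_num_measure.
  rewrite setIC -setDE measureD//; last by rewrite ltey_eq fB.
  rewrite [X in (_ - X)%E](_ : _ = (P S * P B)%E); last by rewrite setIC; exact: PS.
  rewrite probability_setC// -(fineK fS) -(fineK fB) -EFinM -!EFinB -EFinM.
  by rewrite -[X in (X - _)%E](fineK fB) -EFinB; congr (_%:E); ring.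
- move=> F mF tF PF.
  have mFT n : d.-measurable (F n : set T) := sub_generated_measurable Gm (mF n).
  rewrite setI_bigcupl measure_bigcup//=; last 2 first.
  + by move=> i _; exact: measurableI.
  + exact: trivIset_setIr.
  rewrite measure_bigcup//=.
  rewrite muleC -[X in (X * _)%E](fineK fB) -nneseriesZl//.
  by apply: eq_eseriesr => i _; rewrite fineK// muleC; exact: PF.
Qed.

(** Independence makes the joint law a product measure; then Tonelli. *)
Lemma indep_integral (U V : {mfun T >-> R}) (g : R * R -> \bar R) :
  (forall A B, measurable A -> measurable B ->
     P (U @^-1` A `&` V @^-1` B) = (P (U @^-1` A) * P (V @^-1` B))%E) ->
  measurable_fun setT g -> (forall x, 0 <= g x)%E ->
  (\int[P]_w g (U w, V w) = \int[P]_w \int[distribution P U]_x g (x, V w))%E.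
Proof.
move=> UV mg g0.
have mUV : measurable_fun setT (fun w => (U w, V w)) by exact: measurable_fun_pair.
pose UV' : {mfun T >-> (R * R)%type} := HB.pack (fun w => (U w, V w))
  (isMeasurableFun.Build _ _ _ _ _ mUV).
transitivity (\int[distribution P UV']_z g z)%E.
  by rewrite ge0_integral_distribution.
transitivity (\int[distribution P U \x distribution P V]_z g z)%E.
  apply: eq_measure_integral => A mA _.
  by apply/esym; apply: product_measure_unique => // B C mB mC; exact: UV.
rewrite fubini_tonelli2// ge0_integral_distribution//.
- exact: measurable_fun_fubini_tonelli_G.
- by move=> y; exact: integral_ge0.
Qed.

End independence.

(** * Expectations and the weak law of large numbers *)

Section has_mean.
Context {R : realType} d (T : measurableType d) (P : probability T R).
Implicit Types (f g : T -> R) (a b c : R).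

(** Integrability and the value of the integral in a single relation, so that
    expectations of real functions can be computed structurally, without
    extended-real side conditions. *)
Definition has_mean f c :=
  P.-integrable setT (EFin \o f) /\ (\int[P]_w (f w)%:E = c%:E)%E.

Lemma has_mean_measurable f c : has_mean f c -> measurable_fun setT f.
Proof. by move=> [/measurable_int/measurable_EFinP]. Qed.

Lemma has_mean_unique f a b : has_mean f a -> has_mean f b -> a = b.
Proof. by move=> [_ ha] [_]; rewrite ha => -[]. Qed.

Lemma has_mean_integrable f : P.-integrable setT (EFin \o f) ->
  has_mean f (fine (\int[P]_w (f w)%:E)).
Proof.
by move=> fi; split => //; rewrite fineK//; exact: (integrable_fin_num measurableT fi).
Qed.

Lemma has_mean_ge0 f c : measurable_fun setT f -> (forall w, 0 <= f w) ->
  (\int[P]_w (f w)%:E = c%:E)%E -> has_mean f c.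
Proof.
move=> mf f0 fc; split => //; apply/integrableP; split; first exact/measurable_EFinP.
by under eq_integral do rewrite /= ger0_norm//; rewrite fc ltry.
Qed.

Lemma has_mean_dominated f g c : measurable_fun setT f ->
  (forall w, `|f w| <= g w) -> has_mean g c -> exists a, has_mean f a.
Proof.
move=> mf fg [gi _]; exists (fine (\int[P]_w (f w)%:E)); apply: has_mean_integrable.
apply: (le_integrable measurableT _ _ gi); first exact/measurable_EFinP.
by move=> w _ /=; rewrite lee_fin (le_trans (fg w))// ler_norm.
Qed.

Lemma has_mean_cst a : has_mean (fun=> a) a.
Proof.
split; first exact: finite_measure_integrable_cst.
by rewrite integral_cst// [X in (_ * X)%E](_ : _ = 1%E) ?mule1//; exact: probability_setT.
Qed.

Lemma has_mean_eq f g c : (forall w, f w = g w) -> has_mean f c -> has_mean g c.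
Proof. by move=> /funext ->. Qed.

Lemma has_meanD f g a b : has_mean f a -> has_mean g b ->
  has_mean (fun w => f w + g w) (a + b).
Proof.
move=> [fi fa] [gi gb]; split.
  by have := integrableD measurableT fi gi; apply: eq_integrable.
under eq_integral do rewrite EFinD.
by rewrite integralD_EFin// fa gb.
Qed.

Lemma has_meanZ f k a : has_mean f a -> has_mean (fun w => k * f w) (k * a).
Proof.
move=> [fi fa]; split.
  by have := integrableZl measurableT k fi; apply: eq_integrable.
under eq_integral do rewrite EFinM.
by rewrite integralZl// fa.
Qed.

Lemma has_meanB f g a b : has_mean f a -> has_mean g b ->
  has_mean (fun w => f w - g w) (a - b).
Proof.
move=> fa /(has_meanZ (-1)) gb; have := has_meanD fa gb.
rewrite mulN1r; apply: has_mean_eq => w.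
by rewrite mulN1r.
Qed.

Lemma has_mean_sum I (r : seq I) (Q : pred I) (f : I -> T -> R) (a : I -> R) :
  (forall i, Q i -> has_mean (f i) (a i)) ->
  has_mean (fun w => \sum_(i <- r | Q i) f i w) (\sum_(i <- r | Q i) a i).
Proof.
move=> fa; elim: r => [|i r ih].
  rewrite big_nil; apply: (has_mean_eq _ (has_mean_cst 0)) => w.
  by rewrite big_nil.
rewrite big_cons; case: ifPn => Qi.
  apply: (has_mean_eq _ (has_meanD (fa i Qi) ih)) => w.
  by rewrite big_cons Qi.
by apply: (has_mean_eq _ ih) => w; rewrite big_cons (negbTE Qi).
Qed.

Lemma has_mean_le f g a b : has_mean f a -> has_mean g b ->
  (forall w, f w <= g w) -> a <= b.
Proof.
move=> [fi fa] [gi gb] fg; rewrite -lee_fin -fa -gb.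
by apply: le_integral => // w _; rewrite lee_fin.
Qed.

Lemma has_mean_indic (A : set T) : measurable A ->
  has_mean (\1_A) (fine (P A)).
Proof.
move=> mA; split.
  exact: integrable_indic.
rewrite integral_indic// setIT fineK//.
exact: fin_num_measure.
Qed.

Lemma markov_inequality f a c : has_mean f c -> (forall w, 0 <= f w) -> 0 < a ->
  fine (P [set w | a <= f w]) <= c / a.
Proof.
move=> fc f0 a0; have mA : measurable [set w | a <= f w].
  have := has_mean_measurable fc measurableT (measurable_itv `[a, +oo[).
  rewrite setTI; congr measurable; apply/seteqP.
  by split => w /=; rewrite in_itv/= andbT.
rewrite ler_pdivlMr// mulrC.
apply: (has_mean_le (has_meanZ a (has_mean_indic mA)) fc) => w.
rewrite indicE; case: (boolP (w \in _)) => [|_]; last by rewrite mulr0.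
by rewrite inE/= mulr1.
Qed.

End has_mean.

Lemma prob_cover {R : realType} d (T : measurableType d) (P : probability T R)
    (A B C : set T) : measurable A -> measurable B -> measurable C ->
  A `<=` B `|` C -> fine (P A) <= fine (P B) + fine (P C).
Proof.
move=> mA mB mC ABC.
apply: (has_mean_le (has_mean_indic P mA)
         (has_meanD (has_mean_indic P mB) (has_mean_indic P mC))) => w.
rewrite !indicE; case: (boolP (w \in A)) => [|_]; last by rewrite addr_ge0.
rewrite inE => /ABC[Bw|Cw]; first by rewrite (mem_set Bw) lerDl.
by rewrite (mem_set Cw) lerDr.
Qed.

Lemma integral_law {R : realType} d (T : measurableType d) (P : probability T R)
    (U : {mfun T >-> R}) (f : R -> R) : measurable_fun setT f -> (forall x, 0 <= f x) ->
  (\int[P]_w (f (U w))%:E = \int[distribution P U]_x (f x)%:E)%E.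
Proof.
move=> mf f0; rewrite (@ge0_integral_distribution _ _ _ _ _ P U (EFin \o f))//.
exact/measurable_EFinP.
Qed.

Section law_of_large_numbers.
Context {R : realType} d (T : measurableType d) (P : probability T R)
  (h : nat -> {RV P >-> R}).
Context (h_indep : mutually_independent P (fun i : nat => h i : T -> R)).
Context (h_ident : forall (i : nat) (A : set R), measurable A ->
      distribution P (h i) A = distribution P (h 0%N) A).

Lemma indep_pair i j A B : i != j -> measurable A -> measurable B ->
  P (h i @^-1` A `&` h j @^-1` B) = (P (h i @^-1` A) * P (h j @^-1` B))%E.
Proof.
move=> ij mA mB.
have u : uniq [:: i; j] by rewrite /= inE ij.
pose C k := if k == i then A else B.
have mC k : measurable (C k) by rewrite /C; case: ifP.
have := h_indep u mC; rewrite !big_cons big_nil mule1 /C eqxx eq_sym (negbTE ij) => <-.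
congr (P _); apply/seteqP; split => [w [wi wj] k /=|w hw].
  by rewrite !inE => /orP[] /eqP ->; rewrite ?eqxx ?[j == i]eq_sym ?(negbTE ij).
split; first by have := hw i; rewrite /= eqxx; apply; rewrite inE eqxx.
by have := hw j; rewrite /= [j == i]eq_sym (negbTE ij); apply; rewrite !inE eqxx orbT.
Qed.

Lemma has_mean_ident i (f : R -> R) c : measurable_fun setT f ->
  (forall x, 0 <= f x) -> has_mean P (f \o h 0%N) c -> has_mean P (f \o h i) c.
Proof.
move=> mf f0 [_ fc]; apply: has_mean_ge0; first exact: measurableT_comp.
  by move=> w /=.
rewrite -fc !integral_law//.
by apply: eq_measure_integral => A mA _; exact: h_ident.
Qed.

Lemma has_mean_indep i j (f : R -> R) c : i != j -> measurable_fun setT f ->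
  (forall x, 0 <= f x) -> has_mean P (f \o h 0%N) c ->
  has_mean P (fun w => f (h i w) * f (h j w)) (c * c).
Proof.
move=> ij mf f0 fc.
have [_ fi] := has_mean_ident i mf f0 fc; have [_ fj] := has_mean_ident j mf f0 fc.
apply: has_mean_ge0.
- by apply: measurable_funM; apply: measurableT_comp.
- by move=> w; rewrite mulr_ge0.
rewrite (@indep_integral _ _ _ _ (h i) (h j) (fun z => (f z.1 * f z.2)%:E)); last 3 first.
- by move=> A B; exact: indep_pair.
- apply/measurable_EFinP; apply: measurable_funM; apply: measurableT_comp => //.
- by move=> z; rewrite lee_fin mulr_ge0.
under eq_integral => w _.
  under eq_integral do rewrite /= EFinM.
  rewrite ge0_integralZr; last 4 first.
  - exact: measurableT.
  - exact/measurable_EFinP.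
  - by move=> x _; rewrite lee_fin.
  - by rewrite lee_fin.
  rewrite [X in (X * _)%E](_ : _ = c%:E); last first.
    by rewrite -fi integral_law.
  over.
rewrite ge0_integralZl; last 4 first.
- exact: measurableT.
- by apply/measurable_EFinP; exact: measurableT_comp.
- by move=> x _; rewrite lee_fin.
- rewrite lee_fin; apply: (has_mean_le (has_mean_cst P 0) fc).
  by move=> w /=.
by rewrite [X in (_ * X)%E]fj EFinM.
Qed.

(** Chebyshev's inequality; pairwise independence makes the variance of the sum
    at most [N V]. *)
Lemma weak_law (f : R -> R) (m V : R) (N : nat) (e : R) :
  measurable_fun setT f -> (forall x, 0 <= f x) ->
  has_mean P (f \o h 0%N) m -> has_mean P (fun w => f (h 0%N w) ^+ 2) V ->
  (0 < N)%N -> 0 < e ->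
  fine (P [set w | N%:R * e <= `|\sum_(i < N) f (h i w) - N%:R * m|]) <=
  V / (N%:R * e ^+ 2).
Proof.
move=> mf f0 fm fV N0 e0; have NR : 0 < N%:R :> R by rewrite ltr0n.
pose S w := \sum_(i < N) (f (h i w) - m).
have SE w : S w = \sum_(i < N) f (h i w) - N%:R * m.
  by rewrite /S sumrB sumr_const card_ord mulr_natl.
have S2 : has_mean P (fun w => S w ^+ 2) (N%:R * (V - m ^+ 2)).
  pose c (i j : 'I_N) := (if i == j then V else m * m) - m * m - m * m + m * m.
  have -> : N%:R * (V - m ^+ 2) = \sum_(i < N) \sum_(j < N) c i j.
    under eq_bigr => i _.
      rewrite (bigD1 i)//= big1 => [|j ji]; last by rewrite /c eq_sym (negbTE ji); ring.
      rewrite /c eqxx addr0; over.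
    by rewrite sumr_const card_ord -[RHS]mulr_natl; congr (_ * _); ring.
  apply: (has_mean_eq (f := fun w => \sum_(i < N) \sum_(j < N) (f (h i w) - m) *
    (f (h j w) - m))).
    by move=> w; rewrite expr2 /S big_distrlr.
  apply: has_mean_sum => i _; apply: has_mean_sum => j _.
  apply: (has_mean_eq (f := fun w => f (h i w) * f (h j w) - m * f (h i w) - m * f
    (h j w) + m * m)).
    by move=> w; ring.
  apply: has_meanD; last exact: has_mean_cst.
  apply: has_meanB; last exact: has_meanZ (has_mean_ident j mf f0 fm).
  apply: has_meanB; last exact: has_meanZ (has_mean_ident i mf f0 fm).
  have [<-|ij] := eqVneq i j; last exact: has_mean_indep.
  exact: (has_mean_ident i (measurable_funX 2 mf) (fun x => sqr_ge0 (f x)) fV).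
have -> : [set w | N%:R * e <= `|\sum_(i < N) f (h i w) - N%:R * m|] =
    [set w | (N%:R * e) ^+ 2 <= S w ^+ 2].
  apply/seteqP; split => w /=; rewrite -SE -(real_normK (num_real (S w))).
    by move=> ?; rewrite lerXn2r// nnegrE mulr_ge0// ltW.
  by rewrite ler_pXn2r// nnegrE mulr_ge0// ltW.
apply: (le_trans (markov_inequality S2 _ _)).
- by move=> w; exact: sqr_ge0.
- by rewrite exprn_gt0// mulr_gt0.
have -> : N%:R * (V - m ^+ 2) / (N%:R * e) ^+ 2 = (V - m ^+ 2) / (N%:R * e ^+ 2).
  by field; rewrite !gt_eqF.
rewrite ler_pM2r ?invr_gt0 ?mulr_gt0 ?exprn_gt0//.
by rewrite gerBl sqr_ge0.
Qed.

End law_of_large_numbers.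

(** * Measurability of the observables *)

Section measurability.
Context {R : realType}.

Lemma measurable_cosh : measurable_fun setT (@cosh R).
Proof.
apply: measurable_funM => //; apply: measurable_funD; first exact: measurable_expR.
by apply: measurableT_comp; [exact: measurable_expR|exact: measurable_funN].
Qed.

Lemma measurable_tanh : measurable_fun setT (@tanh R).
Proof.
rewrite (_ : @tanh R = fun x => sinh x * expR (- ln (cosh x))); last first.
  by apply/funext => x; rewrite /tanh expRN lnK// posrE cosh_gt0.
apply: measurable_funM.
  apply: measurable_funM => //; apply: measurable_funB; first exact: measurable_expR.
  by apply: measurableT_comp; [exact: measurable_expR|exact: measurable_funN].
apply: measurableT_comp; first exact: measurable_expR.
apply: measurableT_comp; first exact: measurable_funN.
by apply: measurableT_comp; [exact: measurable_ln|exact: measurable_cosh].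
Qed.

Lemma measurable_ln_cosh (t : R) : measurable_fun setT (fun x => ln (cosh (t * x))).
Proof.
apply: measurableT_comp; first exact: measurable_ln.
by apply: measurableT_comp; [exact: measurable_cosh|exact: measurable_funM].
Qed.

Lemma measurable_tanhM (t : R) : measurable_fun setT (fun x => tanh (t * x)).
Proof. by apply: measurableT_comp; [exact: measurable_tanh|exact: measurable_funM]. Qed.

Lemma measurable_ge d (T : measurableType d) (f : T -> R) (c : R) :
  measurable_fun setT f -> measurable [set w | c <= f w].
Proof.
move=> mf; have := mf measurableT `[c, +oo[%classic (measurable_itv _).
rewrite setTI; congr measurable; apply/seteqP.
by split => w /=; rewrite in_itv/= andbT.
Qed.

Lemma measurable_lt d (T : measurableType d) (f : T -> R) (c : R) :
  measurable_fun setT f -> measurable [set w | f w < c].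
Proof.
move=> mf; have := mf measurableT `]-oo, c[%classic (measurable_itv _).
by rewrite setTI.
Qed.

End measurability.

(** * Partition sums and logistic weights *)

Section log_sum_exp.
Context {R : realType} (I : finType).
Implicit Types (A B : I -> R).

Lemma sum_expR_gt0 (i0 : I) A : 0 < \sum_i expR (A i).
Proof.
by rewrite (bigD1 i0)//= ltr_pwDl ?expR_gt0// sumr_ge0// => i _; exact: expR_ge0.
Qed.

(** Convexity of log-sum-exp: with [c] the mean of [B] under the Gibbs law of
    [A], sum the tangent-line bound [e^(B i) >= e^c (1 + (B i - c))]. *)
Lemma log_sum_exp_tangent (i0 : I) A B :
  \sum_i expR (A i) / (\sum_j expR (A j)) * B i <=
  ln (\sum_i expR (A i + B i)) - ln (\sum_i expR (A i)).
Proof.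
set Z := \sum_j expR (A j); have Z0 : 0 < Z by exact: sum_expR_gt0.
set c := \sum_i _; rewrite -ln_div ?posrE//; last exact: sum_expR_gt0.
rewrite -[leLHS]expRK ler_ln ?posrE ?expR_gt0 ?divr_gt0//; last exact: sum_expR_gt0.
rewrite ler_pdivlMr//.
apply: (@le_trans _ _ (\sum_i expR (A i) * (expR c * (1 + (B i - c))))).
  rewrite le_eqVlt; apply/orP; left; apply/eqP.
  transitivity (\sum_i (expR c * (1 - c) * expR (A i) + expR c * Z *
    (expR (A i) / Z * B i))).
    by rewrite big_split/= -!mulr_sumr -/Z -/c; ring.
  by apply: eq_bigr => i _; field; rewrite gt_eqF.
apply: ler_sum => i _; rewrite expRD ler_pM2l ?expR_gt0//.
have -> : expR (B i) = expR c * expR (B i - c) by rewrite -expRD; congr expR; ring.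
by rewrite ler_pM2l ?expR_gt0// expR_ge1Dx.
Qed.

(** This is [(sum_i z_i)^m <= sum_i z_i^m]: the normalized terms are at most one,
    and raising to the power [m <= 1] can only increase them. *)
Lemma expR_ln_sum_le (i0 : I) A (m : R) : m <= 1 ->
  expR (m * ln (\sum_i expR (A i))) <= \sum_i expR (m * A i).
Proof.
move=> m1; set Z := \sum_i expR (A i); have Z0 : 0 < Z by exact: sum_expR_gt0.
rewrite -[leLHS]mul1r -ler_pdivlMr ?expR_gt0// mulr_suml.
have <- : \sum_i expR (A i) / Z = 1 by rewrite -mulr_suml divff// gt_eqF.
apply: ler_sum => i _; rewrite -expRB -mulrBr -{1}(lnK Z0) -expRB ler_expR.
rewrite -[leLHS]mul1r ler_wnM2r// subr_le0 -ler_expR lnK ?posrE//.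
by rewrite /Z (bigD1 i)//= lerDl sumr_ge0// => j _; exact: expR_ge0.
Qed.

End log_sum_exp.

Section logistic.
Context {R : realType} (beta : R) (beta0 : 0 < beta).

(** A Gibbs weight as a function of its own Gaussian energy [x] and of a variable
    [u] that collects the rest of the disorder.  The absolute value makes it a
    bounded function on the whole plane. *)
Definition logistic (x u : R) : R := (1 + `|u| * expR (- beta * x))^-1.

Let den_gt0 (x u : R) : 0 < 1 + `|u| * expR (- beta * x).
Proof. by rewrite ltr_pwDl// mulr_ge0 ?expR_ge0. Qed.

Lemma logistic_ge0 (x u : R) : 0 <= logistic x u.
Proof. by rewrite invr_ge0 ltW. Qed.

Lemma logistic_le1 (x u : R) : logistic x u <= 1.
Proof. by rewrite invf_le1// lerDl mulr_ge0 ?expR_ge0. Qed.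

Lemma logistic_derive (u x : R) :
  is_derive x (1 : R) (logistic ^~ u) (beta * (logistic x u * (1 - logistic x u))).
Proof.
pose g (y : R) := 1 + `|u| * expR (- beta * y).
have dg : is_derive x (1 : R) g (- beta * (g x - 1)).
  have H := is_derive1_comp (is_derive_expR (- beta *: x))
    (is_deriveZ (- beta) (is_derive_id x (1 : R))).
  have H' := is_deriveD (is_derive_cst (1 : R) x (1 : R)) (is_deriveZ `|u| H).
  apply: (is_derive_eq H').
  by rewrite /g /GRing.scale/=; ring.
have g0 : g x != 0 by rewrite gt_eqF// den_gt0.
have dgx : derivable g x 1 by exact: ex_derive.
split; first exact: derivableV.
rewrite deriveV// derive_val /GRing.scale/= /logistic -/(g x).
by field.
Qed.

Lemma measurable_logistic : measurable_fun setT (fun z : R * R => logistic z.1 z.2).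
Proof.
have -> : (fun z : R * R => logistic z.1 z.2) =
    (fun z => expR (- ln (1 + `|z.2| * expR (- beta * z.1)))).
  by apply/funext => z; rewrite expRN lnK// posrE den_gt0.
apply: measurableT_comp; first exact: measurable_expR.
apply: measurableT_comp => //; apply: measurableT_comp; first exact: measurable_ln.
apply: measurable_funD => //; apply: measurable_funM.
  exact: measurableT_comp.
apply: measurableT_comp; first exact: measurable_expR.
exact: measurable_funM.
Qed.

Lemma logistic_ibp (v u : R) : 0 < v ->
  (\int[normal_prob 0 (Num.sqrt v)]_x (Num.max x 0 * logistic x u)%:E =
   \int[normal_prob 0 (Num.sqrt v)]_x (Num.max (- x) 0 * logistic x u +
     v * (beta * (logistic x u * (1 - logistic x u))))%:E)%E.
Proof.
move=> v0; apply: (normal_ibp v0 (C := 1 + beta)).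
- by move=> x; exact: logistic_derive.
- have c : continuous (logistic ^~ u).
    by move=> x; apply: differentiable_continuous; apply/derivable1_diffP;
      apply: (@ex_derive _ _ _ _ _ _ _ (logistic_derive u x)).
  move=> x; apply: cvgM; first exact: cvg_cst.
  apply: cvgM; first exact: c.
  by apply: cvgB; [exact: cvg_cst|exact: c].
- by move=> x; rewrite logistic_ge0 (le_trans (logistic_le1 _ _))// lerDl ltW.
move=> x; have l0 := logistic_ge0 x u; have l1 := logistic_le1 x u.
have ll : 0 <= logistic x u * (1 - logistic x u) <= 1.
  by rewrite mulr_ge0 ?subr_ge0//= mulr_ile1 ?subr_ge0// lerBlDr lerDl.
move: ll => /andP[ll0 ll1]; rewrite mulr_ge0 ?(ltW beta0)//=.
by rewrite (@le_trans _ _ beta) ?lerDr// ler_piMr// ltW.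
Qed.

End logistic.

(** * The random energy model in a random field *)

(** The Gaussian tail at [N (t - eta)] times a number [e^(N t^2/2)] of trials,
    reduced by a factor [e^(- N eta t/4)], still grows: lowering the target by
    [eta] gains at least [eta t/2] in the exponent.  A linear lower bound
    suffices for what follows. *)
Lemma tail_times_entropy {R : realType} (N : nat) (t eta : R) : (0 < N)%N ->
  0 < t -> 0 < eta <= t ->
  expR (- t - 1) * (eta * t / 4) ^+ 2 / (4 * (1 + 2 * pi)) * N%:R <=
  normal_peak (Num.sqrt N%:R) * expR (- (N%:R * (t - eta) + 1) ^+ 2 / (2 * N%:R)) *
   (expR (N%:R * (t ^+ 2 / 2 - eta * t / 4)) / 2).
Proof.
move=> N0 t0 /andP[e0 et].
have NR : 0 < N%:R :> R by rewrite ltr0n.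
have N1 : 1 <= N%:R :> R by rewrite ler1n.
have pi0 := pi_gt0 R.
pose k := eta * t / 4; rewrite -/k.
have k0 : 0 < k by rewrite /k divr_gt0// mulr_gt0.
set A := (X in expR X); set B := (X in _ * expR X * _).
have peak : (N%:R * (1 + 2 * pi))^-1 <= normal_peak (Num.sqrt (N%:R : R)).
  rewrite /normal_peak sqr_sqrtr ?(ltW NR)// lef_pV2 ?posrE; last 2 first.
  - by rewrite mulr_gt0//; lra.
  - by rewrite sqrtr_gt0 pmulrn_lgt0// mulr_gt0.
  have x0 : 0 <= N%:R * pi *+ 2 :> R by rewrite mulrn_wge0// mulr_ge0 ?ltW.
  apply: (@le_trans _ _ (1 + N%:R * pi *+ 2)).
    have x1 : 0 <= 1 + N%:R * pi *+ 2 :> R by rewrite addr_ge0.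
    rewrite -(ger0_norm x1) -sqrtr_sqr ler_wsqrtr//.
    by move: x0; set x := _ *+ _ => x0; nra.
  by rewrite -mulr_natr; nra.
have expo : N%:R * k - t - 1 <= B + N%:R * (t ^+ 2 / 2 - eta * t / 4).
  have -> : B = - (N%:R * (t - eta) ^+ 2 / 2 + (t - eta) + (2 * N%:R)^-1).
    by rewrite /B; field; rewrite gt_eqF.
  have : (2 * N%:R)^-1 <= 1 :> R by rewrite invf_le1 ?mulr_gt0//; lra.
  have : N%:R * k <= N%:R * (t ^+ 2 / 2 - eta * t / 4 - (t - eta) ^+ 2 / 2).
    by rewrite ler_pM2l// /k; nra.
  by rewrite mulrBr; lra.
rewrite -[leRHS]mulrA [X in _ <= _ * X]mulrA -expRD.
apply: (@le_trans _ _ ((N%:R * (1 + 2 * pi))^-1 * (expR (N%:R * k - t - 1) / 2)));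
  last first.
  apply: ler_pM; [|by rewrite divr_ge0// expR_ge0|exact: peak|].
    by rewrite invr_ge0 mulr_ge0//; lra.
  by rewrite ler_pM2r ?invr_gt0// ler_expR.
have -> : N%:R * k - t - 1 = A + N%:R * k by rewrite /A; ring.
rewrite (expRD A).
have := @expR_ge1Dxn R (N%:R * k) 1 (mulr_ge0 (ltW NR) (ltW k0)).
rewrite !factS fact0 !muln1 => h.
have h' : (N%:R * k) ^+ 2 / 2 <= expR (N%:R * k) by lra.
apply: (@le_trans _ _ ((N%:R * (1 + 2 * pi))^-1 * (expR A * ((N%:R * k) ^+ 2 / 2) / 2))).
  have p0 : 1 + 2 * pi != 0 :> R by rewrite gt_eqF//; lra.
  have n0 : N%:R != 0 :> R by rewrite gt_eqF.
  rewrite le_eqVlt; apply/orP; left; apply/eqP.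
  by move: (pi : R) p0 => p p0; field; rewrite p0 n0.
rewrite ler_pM2l ?invr_gt0 ?mulr_gt0//; last by lra.
by rewrite ler_pM2r ?invr_gt0// ler_pM2l ?expR_gt0.
Qed.

Section random_energy_model_in_random_field.
Context {R : realType} d (Omega : measurableType d) (P : probability Omega R)
  (X : forall N, configuration N -> {RV P >-> R}) (h : nat -> {RV P >-> R}).
Context (X_indep : forall N : nat, (0 < N)%N ->
  mutually_independent P (fun s : configuration N => X s : Omega -> R)).
Context (X_gauss : forall (N : nat) (s : configuration N), (0 < N)%N ->
  forall A : set R, measurable A ->
    distribution P (X s) A = normal_prob 0 (Num.sqrt N%:R) A).
Context (h_indep : mutually_independent P (fun i : nat => h i : Omega -> R)).
Context (h_ident : forall (i : nat) (A : set R), measurable A ->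
  distribution P (h i) A = distribution P (h 0%N) A).
Context (hX_indep : independent_families P
  [set: nat] (fun i : nat => h i : Omega -> R)
  [set p : {N : nat & configuration N} | (0 < tag p)%N]
  (fun p : {N : nat & configuration N} => X (tagged p) : Omega -> R)).

Notation sigma_h := (sigma_family [set: nat] (fun i : nat => h i : Omega -> R)).

(** ** One energy against the rest of the disorder *)

Lemma sigma_family_measurable I (D : set I) (Y : I -> {mfun Omega >-> R}) A :
  sigma_family D (fun i => Y i : Omega -> R) A -> measurable A.
Proof.
apply: sub_generated_measurable => B [i _ [C mC <-]].
by rewrite setTI; exact: measurable_funPTI.
Qed.

Lemma sigma_family_preimage I (D : set I) (Y : I -> Omega -> R) i B :
  D i -> measurable B -> sigma_family D Y (Y i @^-1` B).
Proof.
move=> Di mB; apply: sub_sigma_algebra; exists i => //.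
by exists B => //; rewrite setTI.
Qed.

Lemma sigma_X_bigcap N (l : seq (configuration N)) (B : configuration N -> set R) :
  (0 < N)%N -> (forall s, measurable (B s)) ->
  sigma_family [set p : {N : nat & configuration N} | (0 < tag p)%N]
    (fun p : {N : nat & configuration N} => X (tagged p) : Omega -> R)
    (\bigcap_(s in [set` l]) X s @^-1` B s).
Proof.
move=> N0 mB.
have := @fin_bigcap_measurable _ (g_sigma_algebraType
  (\bigcup_(p in [set p : {N : nat & configuration N} | (0 < tag p)%N])
     preimage_set_system setT (X (tagged p) : Omega -> R) measurable)) _
  [set` l] (fun s => X s @^-1` B s).
apply; first exact: finite_seq.
move=> s _.
exact: (@sigma_family_preimage _ _ (fun p : {N : nat & configuration N} =>
  X (tagged p) : Omega -> R) (Tagged (fun N => configuration N) s)).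
Qed.

(** A pi-system that generates the sigma-algebra of the field and of all
    Gaussian energies except that of [s0]. *)
Definition rest_system N (s0 : configuration N) : set (set Omega) :=
  [set A | exists D, exists B : configuration N -> set R,
    [/\ sigma_h D, forall s, measurable (B s) &
        A = D `&` \bigcap_(s in [set s | s != s0]) X s @^-1` B s]].

Lemma rest_system_setI N (s0 : configuration N) : setI_closed (rest_system s0).
Proof.
move=> _ _ [D [B [sD mB ->]]] [D' [B' [sD' mB' ->]]].
exists (D `&` D'), (fun s => B s `&` B' s); split.
- exact: (@measurableI _ (g_sigma_algebraType _) D D').
- by move=> s; exact: measurableI.
rewrite setIACA -bigcapI; congr (_ `&` _).
Qed.

Lemma rest_system_measurable N (s0 : configuration N) :
  rest_system s0 `<=` measurable.
Proof.
move=> _ [D [B [sD mB ->]]]; apply: measurableI.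
  exact: sigma_family_measurable sD.
apply: fin_bigcap_measurable => [|s _]; first exact: finite_finset.
exact: measurable_funPTI.
Qed.

Lemma rest_system_indep N (s0 : configuration N) A C : (0 < N)%N ->
  rest_system s0 A -> measurable C ->
  P (A `&` X s0 @^-1` C) = (P A * P (X s0 @^-1` C))%E.
Proof.
move=> N0 [D [B [sD mB ->]]] mC.
pose l := enum [pred s : configuration N | s != s0].
have lE : [set` l] = [set s | s != s0].
  by apply/seteqP; split => s /=; rewrite mem_enum.
have s0l : s0 \notin l by rewrite mem_enum inE eqxx.
pose B' s := if s == s0 then C else B s.
have mB' s : measurable (B' s) by rewrite /B'; case: ifP.
have B'E : (\bigcap_(s in [set s | s != s0]) X s @^-1` B s) `&` X s0 @^-1` C =
    \bigcap_(s in [set` s0 :: l]) X s @^-1` B' s.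
  rewrite (_ : [set` s0 :: l] = s0 |` [set` l]); last first.
    by apply/seteqP; split => s /=; rewrite inE => /predU1P.
  rewrite bigcap_setU1 -lE setIC; congr (_ `&` _).
    by rewrite /B' eqxx.
  apply: eq_bigcapr => s /=; rewrite mem_enum inE /B' => /negbTE ->.
  by [].
rewrite -setIA B'E hX_indep//; last exact: sigma_X_bigcap.
rewrite -lE hX_indep//; last exact: sigma_X_bigcap.
have ul : uniq l by exact: enum_uniq.
have us : uniq (s0 :: l) by rewrite /= s0l.
rewrite (X_indep N0 us mB') (X_indep N0 ul mB).
rewrite big_cons {1}/B' eqxx -muleA; congr (_ * _)%E.
rewrite muleC; congr (_ * _)%E.
apply: eq_big_seq => s; rewrite mem_enum inE /B' => /negbTE ->.
by [].
Qed.

(** The probability space with that sigma-algebra: a function of the rest of the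
    disorder is one that is measurable on this type, which the usual closure
    lemmas establish. *)
Definition rest_type N (s0 : configuration N) := g_sigma_algebraType (rest_system s0).

Lemma rest_measurable_fun N (s0 : configuration N) (U : Omega -> R) :
  measurable_fun [set: rest_type s0] (U : rest_type s0 -> R) ->
  measurable_fun [set: Omega] U.
Proof.
move=> mU _ B mB; rewrite setTI.
apply: (sub_generated_measurable (@rest_system_measurable N s0)).
by have := mU measurableT B mB; rewrite setTI.
Qed.

Lemma rest_measurable_X N (s0 s : configuration N) : s != s0 ->
  measurable_fun [set: rest_type s0] (X s : rest_type s0 -> R).
Proof.
move=> ss0 _ B mB; rewrite setTI; apply: sub_sigma_algebra.
exists setT, (fun s' => if s' == s then B else setT); split.
- exact: (@measurableT _ (g_sigma_algebraType _)).
- by move=> s'; case: ifP.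
rewrite setTI; apply/seteqP; split => [w Xw s'/= _|w /(_ s ss0)/=].
  by case: eqP => [->|].
by rewrite eqxx.
Qed.

Lemma rest_measurable_h N (s0 : configuration N) i :
  measurable_fun [set: rest_type s0] (h i : rest_type s0 -> R).
Proof.
move=> _ B mB; rewrite setTI; apply: sub_sigma_algebra.
exists (h i @^-1` B), (fun=> setT); split => //.
- exact: (@sigma_family_preimage _ _ (fun i => h i : Omega -> R)).
- by apply/seteqP; split => [w hw|w []//]; split.
Qed.

(** The energy of [s0] can be integrated out with the rest of the disorder frozen. *)
Lemma rest_integral N (s0 : configuration N) (U : Omega -> R) (g : R * R -> \bar R) :
  (0 < N)%N -> measurable_fun [set: rest_type s0] (U : rest_type s0 -> R) ->
  measurable_fun setT g -> (forall x, 0 <= g x)%E ->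
  (\int[P]_w g (X s0 w, U w) =
   \int[P]_w \int[distribution P (X s0)]_x g (x, U w))%E.
Proof.
move=> N0 mU mg g0.
pose U' : {mfun Omega >-> R} := HB.pack U
  (isMeasurableFun.Build _ _ _ _ _ (rest_measurable_fun mU)).
apply: (@indep_integral _ _ _ _ (X s0) U') => // A B mA mB.
rewrite setIC muleC; apply: (@indep_generated _ _ _ P (rest_system s0)).
- exact: rest_system_setI.
- exact: rest_system_measurable.
- exact: measurable_funPTI.
- by move=> A' rA'; exact: rest_system_indep.
- by have := mU measurableT B mB; rewrite setTI.
Qed.

(** ** Existence of a state of extremal energy *)

(** On the event that the [sigma_h]-measurable random set [A] of configurations
    equals a given [S], the energies indexed by [S] are independent of the event,
    so that all of them stay below [b] with conditional probability at most
    [e^(- p |S|)].  Sum over [S]. *)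
Lemma no_large_energy N (b p K : R) (G : set Omega) (A : Omega -> configuration N -> bool) :
  (0 < N)%N -> sigma_h G -> (forall s, sigma_h [set w | A w s]) ->
  (forall w, G w -> K <= #|A w|%:R) ->
  (forall s : configuration N, fine (P [set w | X s w < b]) <= expR (- p)) -> 0 <= p ->
  fine (P (G `&` [set w | forall s : configuration N, A w s -> X s w < b])) <= expR
    (- (p * K)).
Proof.
move=> N0 sG sA GK Xp p0.
have mh C : sigma_h C -> measurable C by exact: sigma_family_measurable.
pose E (S : {ffun configuration N -> bool}) := G `&` [set w | forall s, A w s = S s].
have sE S : sigma_h (E S).
  apply: (@measurableI _ (g_sigma_algebraType _)) => //.
  rewrite (_ : [set w | _] = \bigcap_(s in [set: configuration N])
    (if S s then [set w | A w s] else ~` [set w | A w s])).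
    apply: (@fin_bigcap_measurable _ (g_sigma_algebraType _)); first exact: finite_finset.
    by move=> s _; case: ifP => _; [|apply: measurableC]; exact: sA.
  apply/seteqP; split => [w Aw s _|w Aw s].
    by rewrite -Aw; case: ifPn => //= /negP.
  by have := Aw s I; case: ifP => /= _ => [->//|/negP/negbTE].
pose F := G `&` [set w | forall s : configuration N, A w s -> X s w < b].
pose L (S : {ffun configuration N -> bool}) := \bigcap_(s in [set` enum [pred s | S s]])
  X s @^-1` `]-oo, b[%classic.
have mL S : measurable (L S).
  by apply: fin_bigcap_measurable => [|s _]; [exact: finite_seq|exact: measurable_funPTI].
have mF : measurable F.
  apply: measurableI; first exact: mh.
  rewrite (_ : [set w | _] = \bigcap_(s in [set: configuration N])
      (~` [set w | A w s] `|` X s @^-1` `]-oo, b[%classic)); last first.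
    apply/seteqP; split => [w Fw s _|w Fw s As].
      by have [As|As] := pselect (A w s); [right; rewrite /= in_itv/=; exact: Fw|left].
    by have [/(_ As)//|] := Fw s I; rewrite /= in_itv.
  apply: fin_bigcap_measurable => [|s _]; first exact: finite_finset.
  by apply: measurableU; [apply: measurableC; exact: mh|exact: measurable_funPTI].
have PE S : fine (P (E S `&` L S)) <= expR (- (p * K)) * fine (P (E S)).
  have [[w [Gw Sw]]|/set0P/negP/negPn/eqP ->] := pselect (E S !=set0); last first.
    by rewrite set0I measure0 mulr0.
  rewrite hX_indep//; last by apply: sigma_X_bigcap => // s; exact: measurable_itv.
  rewrite (X_indep N0 (enum_uniq _) (fun=> measurable_itv _)).
  pose r (s : configuration N) := fine (P (X s @^-1` `]-oo, b[%classic)).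
  have -> : (\prod_(s <- enum [pred s | S s]) P (X s @^-1` `]-oo, b[%classic))%E =
    (\prod_(s <- enum [pred s | S s]) r s)%:E.
    rewrite (big_morph EFin EFinM erefl); apply: eq_bigr => s _.
    by rewrite fineK//; apply: fin_num_measure; exact: measurable_funPTI.
  rewrite fineM//; last by apply: fin_num_measure; exact: mh.
  rewrite mulrC/= ler_wpM2r ?fine_ge0//.
  rewrite big_enum/=.
  apply: (@le_trans _ _ (\prod_(s in [pred s | S s]) expR (- p))).
    apply: ler_prod => s _; rewrite fine_ge0//=; exact: Xp.
  rewrite prodr_const -expRM_natr ler_expR mulNr lerN2 ler_wpM2l//.
  apply: le_trans (GK w Gw) _; rewrite ler_nat.
  by apply/eq_leq/eq_card => s; rewrite inE -[LHS]/(A w s) Sw.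
have mean1 : has_mean P (fun w => \sum_S \1_(E S) w) (\sum_S fine (P (E S))).
  by apply: has_mean_sum => S _; apply: has_mean_indic; exact: mh.
have mean2 : has_mean P (fun w => \sum_S \1_(E S `&` L S) w)
  (\sum_S fine (P (E S `&` L S))).
  by apply: has_mean_sum => S _; apply: has_mean_indic; apply: measurableI => //; exact: mh.
apply: (@le_trans _ _ (\sum_S fine (P (E S `&` L S)))).
  apply: (has_mean_le (has_mean_indic P mF) mean2) => w.
  rewrite indicE; case: (boolP (w \in F)) => [|_]; last exact: sumr_ge0.
  rewrite inE => -[Gw Fw]; pose S := [ffun s => A w s].
  rewrite (bigD1 S)//= indicE mem_set ?lerDl ?sumr_ge0//.
  split; first by split => // s; rewrite ffunE.
  by move=> s /=; rewrite mem_enum inE in_itv/= ffunE; exact: Fw.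
apply: le_trans (ler_sum _ (fun S _ => PE S)) _; rewrite -mulr_sumr ler_piMr ?expR_ge0//.
apply: (has_mean_le mean1 (has_mean_cst P 1)) => w.
have [[S0 [Gw S0w]]|noS] := pselect (exists S, E S w); last first.
  rewrite big1// => S _; rewrite indicE memNset// => ES.
  by apply: noS; exists S.
rewrite (bigD1 S0)//= big1 ?addr0 => [|S SS0]; first by rewrite indicE; case: (_ \in _).
rewrite indicE memNset// => -[_ Sw]; move/eqP: SS0; apply.
by apply/ffunP => s; rewrite -Sw -S0w.
Qed.

Context (beta t lam a q v2 : R) (t0 : 0 < t) (tb : t < beta).
Context (Hlam : has_mean P (fun w => ln (cosh (t * h 0%N w))) lam).
Context (Ha : has_mean P (fun w => h 0%N w * tanh (t * h 0%N w)) a).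
Context (Hq : has_mean P (fun w => tanh (t * h 0%N w) ^+ 2) q).
Context (Hv : has_mean P (fun w => h 0%N w ^+ 2) v2).
Context (crit : t ^+ 2 / 2 = ln 2 + lam - t * a).

Let beta0 : 0 < beta. Proof. exact: lt_trans tb. Qed.

(** Quadratic growth of the square of the observable is enough, since the field
    has a second moment. *)
Lemma weak_law_dominated (f : R -> R) (m K : R) :
  measurable_fun setT f -> (forall x, 0 <= f x) ->
  (forall x, f x ^+ 2 <= K * (1 + x ^+ 2)) ->
  has_mean P (fun w => f (h 0%N w)) m ->
  exists V, forall N e, (0 < N)%N -> 0 < e ->
    fine (P [set w | N%:R * e <= `|\sum_(i < N) f (h i w) - N%:R * m|]) <=
    V / (N%:R * e ^+ 2).
Proof.
move=> mf f0 fK fm.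
have [V fV] : exists V, has_mean P (fun w => f (h 0%N w) ^+ 2) V.
  apply: (@has_mean_dominated _ _ _ _ _ _ (K * (1 + v2))).
  - by apply: measurable_funX; exact: measurableT_comp.
  - by move=> w; rewrite ger0_norm ?sqr_ge0//; exact: fK.
  - by apply: has_meanZ; apply: has_meanD => //; exact: has_mean_cst.
by exists V => N e N0 e0; exact: (weak_law h_indep h_ident).
Qed.

Lemma weak_law_ln_cosh : exists V, forall N e, (0 < N)%N -> 0 < e ->
  fine (P [set w | N%:R * e <= `|\sum_(i < N) ln (cosh (t * h i w)) - N%:R * lam|])
   <= V / (N%:R * e ^+ 2).
Proof.
apply: (@weak_law_dominated (fun x => ln (cosh (t * x))) lam (t ^+ 2)) => //.
- exact: measurable_ln_cosh.
- by move=> x; exact: ln_cosh_ge0.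
move=> x; apply: (@le_trans _ _ ((t * x) ^+ 2)).
  rewrite -[leRHS](real_normK (num_real _)).
  by rewrite lerXn2r ?nnegrE ?ln_cosh_ge0// ln_cosh_le.
by rewrite exprMn ler_wpM2l ?sqr_ge0// lerDr.
Qed.

Lemma weak_law_tanh : exists V, forall N e, (0 < N)%N -> 0 < e ->
  fine (P [set w | N%:R * e <= `|\sum_(i < N) h i w * tanh (t * h i w) - N%:R * a|])
   <= V / (N%:R * e ^+ 2).
Proof.
apply: (@weak_law_dominated (fun x => x * tanh (t * x)) a 1) => //.
- by apply: measurable_funM => //; exact: measurable_tanhM.
- by move=> x; rewrite mulr_tanh_ge0// ltW.
move=> x; apply: (@le_trans _ _ (x ^+ 2)); last by rewrite mul1r lerDr.
by rewrite exprMn ler_piMr ?sqr_ge0 ?tanh_sqr_le1.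
Qed.

Lemma second_moment_tail N e : (0 < N)%N -> 0 < e ->
  fine (P [set w | (N%:R * e) ^+ 2 / 2 <= \sum_(i < N) h i w ^+ 2]) <=
  2 * v2 / (N%:R * e ^+ 2).
Proof.
move=> N0 e0; have NR : 0 < N%:R :> R by rewrite ltr0n.
have H : has_mean P (fun w => \sum_(i < N) h i w ^+ 2) (\sum_(i < N) v2).
  apply: has_mean_sum => i _.
  exact: (has_mean_ident h_ident i (measurable_funX 2 (@measurable_id _ _ _))
    (fun x => sqr_ge0 x) Hv).
apply: (le_trans (markov_inequality H _ _)).
- by move=> w; apply: sumr_ge0 => i _; exact: sqr_ge0.
- by rewrite divr_gt0// exprn_gt0// mulr_gt0.
rewrite sumr_const card_ord -[v2 *+ N]mulr_natl le_eqVlt; apply/orP; left; apply/eqP.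
by field; rewrite !gt_eqF.
Qed.

Lemma measurable_h_sum d' (T : measurableType d') (g : nat -> T -> R)
  (f : nat -> R -> R) N :
  (forall i, measurable_fun setT (g i)) -> (forall i, measurable_fun setT (f i)) ->
  measurable_fun setT (fun w => \sum_(i < N) f i (g i w)).
Proof.
by move=> mg mf; apply: measurable_sum => i; exact: measurableT_comp.
Qed.

Lemma sigma_h_measurable_h i :
  measurable_fun [set: g_sigma_algebraType
    (\bigcup_(i in [set: nat]) preimage_set_system setT (h i : Omega -> R) measurable)]
   (h i : g_sigma_algebraType _ -> R).
Proof.
move=> _ B mB; rewrite setTI.
exact: (@sigma_family_preimage _ setT (fun i => h i : Omega -> R) i B).
Qed.

Lemma sigma_h_ge (f : nat -> R -> R) N c :
  (forall i, measurable_fun setT (f i)) ->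
  sigma_h [set w | c <= \sum_(i < N) f i (h i w)].
Proof.
move=> mf; apply: (@measurable_ge _ _ (g_sigma_algebraType _)).
apply: (@measurable_h_sum _ (g_sigma_algebraType _) (fun i => h i) f) => // i.
exact: sigma_h_measurable_h.
Qed.

Lemma sigma_h_dist (f : R -> R) N c m :
  measurable_fun setT f ->
  sigma_h [set w | c <= `|\sum_(i < N) f (h i w) - m|].
Proof.
move=> mf; apply: (@measurable_ge _ _ (g_sigma_algebraType _)).
apply: measurableT_comp => //; apply: measurable_funB => //.
apply: (@measurable_h_sum _ (g_sigma_algebraType _) (fun i => h i) (fun _ => f)) => // i.
exact: sigma_h_measurable_h.
Qed.

Lemma measurable_hamiltonian N (s : configuration N) :
  measurable_fun setT (fun w => hamiltonian X h w s).
Proof.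
by apply: measurable_funD => //; apply: measurable_sum => i; exact: measurable_funM.
Qed.

Lemma measurable_all_below N (c : R) :
  measurable [set w | forall s : configuration N, hamiltonian X h w s < c].
Proof.
rewrite (_ : [set w | _] = \bigcap_(s in [set: configuration N])
    [set w | hamiltonian X h w s < c]); last first.
  by apply/seteqP; split => w H s; [move=> _|]; exact: H.
apply: fin_bigcap_measurable => [|s _]; first exact: finite_finset.
by apply: measurable_lt; exact: measurable_hamiltonian.
Qed.

(** Off three events of probability [O(1/N)], on which the field is atypical,
    [card_high_energy] provides exponentially many configurations of field energy
    close to [N a], and [no_large_energy] says that one of them has Gaussian energy
    at least [N (t - et)]. *)
Lemma ground_state (eta : R) : 0 < eta -> exists C, forall N, (0 < N)%N ->
  fine (P [set w | forall s : configuration N, hamiltonian X h w s < N%:R * (t + a - eta)])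
  <= C / N%:R.
Proof.
move=> eta0.
pose et := Num.min (eta / 2) t.
have [et0 et_t et_eta] : [/\ 0 < et, et <= t & et <= eta / 2].
  by rewrite /et lt_min t0 andbT divr_gt0// !ge_min !lexx orbT.
(* chosen so that the entropy lost by [card_high_energy] is [et t / 4] *)
pose dl := et * t / (4 * (1 + 2 * t)).
have t12 : 0 < 1 + 2 * t by rewrite addr_gt0// mulr_gt0.
have dl0 : 0 < dl by rewrite divr_gt0 ?mulr_gt0.
have dlE : (1 + 2 * t) * dl = et * t / 4 by rewrite /dl; field; rewrite gt_eqF.
have dl_et : 2 * dl <= et by nra.
have [V1 H1] := weak_law_ln_cosh.
have [V2 H2] := weak_law_tanh.
have pi0 := pi_gt0 R.
pose c := expR (- t - 1) * (et * t / 4) ^+ 2 / (4 * (1 + 2 * pi)).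
have c0 : 0 < c.
  rewrite divr_gt0//; last by rewrite mulr_gt0//; lra.
  by rewrite mulr_gt0 ?expR_gt0// exprn_gt0// divr_gt0// mulr_gt0.
exists ((V1 + V2 + 2 * v2) / dl ^+ 2 + c^-1) => N N0.
have NR : 0 < N%:R :> R by rewrite ltr0n.
pose E1 := [set w | N%:R * dl <= `|\sum_(i < N) ln (cosh (t * h i w)) - N%:R * lam|].
pose E2 := [set w | N%:R * dl <= `|\sum_(i < N) h i w * tanh (t * h i w) - N%:R * a|].
pose E3 := [set w | (N%:R * dl) ^+ 2 / 2 <= \sum_(i < N) h i w ^+ 2].
pose G := ~` (E1 `|` E2 `|` E3).
pose b := N%:R * (t - et).
pose A w (s : configuration N) := N%:R * (a - 2 * dl) <= \sum_(i < N) h i w * spin R s i.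
pose F := G `&` [set w | forall s : configuration N, A w s -> X s w < b].
have s1 : sigma_h E1 by apply: (sigma_h_dist (f := fun x => ln (cosh (t * x))));
  exact: measurable_ln_cosh.
have s2 : sigma_h E2.
  apply: (sigma_h_dist (f := fun x => x * tanh (t * x))).
  by apply: measurable_funM => //; exact: measurable_tanhM.
have s3 : sigma_h E3.
  by apply: (sigma_h_ge (f := fun _ x => x ^+ 2)) => i; exact: measurable_funX.
have sG : sigma_h G.
  apply: (@measurableC _ (g_sigma_algebraType _)).
  by apply: (@measurableU _ (g_sigma_algebraType _)) => //;
    apply: (@measurableU _ (g_sigma_algebraType _)).
have sA s : sigma_h [set w | A w s].
  apply: (@measurable_ge _ _ (g_sigma_algebraType _)).
  apply: measurable_sum => i; apply: measurable_funM => //.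
  exact: sigma_h_measurable_h.
have sub : [set w | forall s : configuration N, hamiltonian X h w s < N%:R * (t + a - eta)]
    `<=` E1 `|` E2 `|` E3 `|` F.
  move=> w Hw; have [Ew|Ew] := pselect ((E1 `|` E2 `|` E3) w); [by left|right].
  split=> // s; rewrite /A => As; have := Hw s; rewrite /hamiltonian => hs.
  have : N%:R * (et + 2 * dl) <= N%:R * eta by rewrite ler_pM2l//; nra.
  by rewrite /b; lra.
have mh C : sigma_h C -> measurable C by exact: sigma_family_measurable.
have mF : measurable F.
  apply: measurableI; first exact: mh.
  rewrite (_ : [set w | _] = \bigcap_(s in [set: configuration N])
      (~` [set w | A w s] `|` [set w | X s w < b])); last first.
    apply/seteqP; split => [w Fw s _|w Fw s As].
      by have [As|As] := pselect (A w s); [right; exact: Fw|left].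
    by have [/(_ As)//|] := Fw s I.
  apply: fin_bigcap_measurable => [|s _]; first exact: finite_finset.
  by apply: measurableU; [apply: measurableC; exact: mh|exact: measurable_lt].
apply: (le_trans (prob_cover P (measurable_all_below N _) _ mF sub)).
  by do 2 (apply: measurableU; last exact: mh); exact: mh.
have PF : fine (P F) <= (c * N%:R)^-1.
  pose p := normal_peak (Num.sqrt N%:R : R) * expR (- (b + 1) ^+ 2 / (2 * N%:R)).
  pose K := expR (N%:R * (t ^+ 2 / 2 - et * t / 4)) / 2.
  have pK : c * N%:R <= p * K by apply: tail_times_entropy => //; rewrite et0.
  have p0 : 0 <= p by rewrite mulr_ge0 ?expR_ge0// normal_peak_ge0.
  have cN : 0 < c * N%:R by rewrite mulr_gt0.
  apply: (@le_trans _ _ (expR (- (p * K)))); last first.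
    rewrite expRN lef_pV2 ?posrE ?expR_gt0//.
    by apply: (le_trans pK); apply: le_trans (expR_ge1Dx _); rewrite lerDr.
  apply: (no_large_energy N0 sG sA _ _ p0).
    move=> w Gw; rewrite /K.
    have nE1 : ~ E1 w by move=> ?; apply: Gw; left; left.
    have nE2 : ~ E2 w by move=> ?; apply: Gw; left; right.
    have nE3 : ~ E3 w by move=> ?; apply: Gw; right.
    have -> : t ^+ 2 / 2 - et * t / 4 = ln 2 + lam - dl - t * (a + 2 * dl).
      by rewrite -dlE crit; ring.
    move/negP: nE1; rewrite -ltNge ltr_norml => /andP[nE1 _].
    move/negP: nE2; rewrite -ltNge => /ltW nE2.
    move/negP: nE3; rewrite -ltNge => /ltW nE3.
    apply: (card_high_energy N0 (ltW t0) dl0 _ nE2 nE3).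
    by rewrite mulrBr; move: nE1; lra.
  move=> s; apply: le_trans (expR_ge1Dx _).
  have mXb : measurable [set w | X s w < b] by exact: measurable_lt.
  have -> : fine (P [set w | X s w < b]) = 1 - fine (P [set w | b <= X s w]).
    rewrite (_ : [set w | b <= X s w] = ~` [set w | X s w < b]); last first.
      by apply/seteqP; split => w /=; [move=> h1; apply/negP; rewrite -leNgt|move/negP;
        rewrite -leNgt].
    rewrite probability_setC// fineB//=; last exact: fin_num_measure.
    by ring.
  rewrite lerD2l lerN2 -lee_fin fineK; last first.
    by apply: fin_num_measure; exact: measurable_ge.
  have b0 : 0 <= b by rewrite mulr_ge0// subr_ge0.
  apply: (le_trans (normal_tail NR b0)).
  rewrite [leLHS](_ : _ = distribution P (X s) `[b, +oo[%classic); last first.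
    by rewrite X_gauss//; exact: measurable_itv.
  rewrite /distribution /pushforward.
  apply: le_measure; [rewrite inE; exact: measurable_funPTI|rewrite inE;
    exact: measurable_ge|].
  by move=> w; rewrite /= in_itv/= andbT.
rewrite mulrDl; apply: lerD; last by rewrite -invfM.
apply: (@le_trans _ _ ((V1 / (N%:R * dl ^+ 2) + V2 / (N%:R * dl ^+ 2)) + 2 * v2 /
  (N%:R * dl ^+ 2))).
  apply: (le_trans (prob_cover P _ (measurableU _ _ (mh _ s1) (mh _ s2)) (mh _ s3)
    (@subset_refl _ _))).
    by apply: measurableU; [apply: measurableU|]; exact: mh.
  apply: lerD; last exact: second_moment_tail.
  apply: (le_trans (prob_cover P _ (mh _ s1) (mh _ s2) (@subset_refl _ _))).
    by apply: measurableU; exact: mh.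
  by apply: lerD; [exact: H1|exact: H2].
by rewrite le_eqVlt; apply/orP; left; apply/eqP; field; rewrite !gt_eqF.
Qed.

(** ** Two distinct samples *)

(** For [H(s) >= M] the bound exceeds one; otherwise the bound with exponent
    [beta] holds because the partition function is at least [e^(beta M)], and it
    improves when [beta] is lowered to [t]. *)
Lemma gibbs_le_exp N (s s0 : configuration N) w M : M <= hamiltonian X h w s0 ->
  gibbs X h beta w s <= expR (t * (hamiltonian X h w s - M)).
Proof.
move=> Ms0; have [Ms|sM] := leP M (hamiltonian X h w s).
  apply: (le_trans (gibbs_le1 X h beta w s)).
  by rewrite -expR0 ler_expR mulr_ge0 ?subr_ge0// ltW.
apply: (@le_trans _ _ (expR (beta * (hamiltonian X h w s - M)))); last first.
  by rewrite ler_expR ler_wnM2r ?ltW// subr_lt0.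
rewrite mulrBr expRB /gibbs ler_pM2l ?expR_gt0// lef_pV2 ?posrE ?expR_gt0//; last first.
  exact: partition_function_gt0.
rewrite /partition_function (bigD1 s0)//= ler_wpDr//.
  by apply: sumr_ge0 => s' _; exact: expR_ge0.
by rewrite ler_expR ler_pM2l//; exact: lt_trans tb.
Qed.

Lemma has_mean_gibbs2 N (p : configuration N * configuration N) :
  has_mean P (fun w => gibbs X h beta w p.1 * gibbs X h beta w p.2)
    (fine (gibbs2_mean X h beta p)).
Proof.
apply: has_mean_ge0.
- by apply: measurable_funM; exact: measurable_gibbs.
- by move=> w; rewrite mulr_ge0 ?gibbs_ge0.
- by rewrite fineK// gibbs2_mean_fin_num.
Qed.

Lemma sum_gibbs2 N w : \sum_(p : configuration N * configuration N)
  gibbs X h beta w p.1 * gibbs X h beta w p.2 = 1.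
Proof.
rewrite -(pair_bigA _ (fun s s' : configuration N =>
  gibbs X h beta w s * gibbs X h beta w s'))/=.
under eq_bigr do rewrite -mulr_sumr sum_gibbs mulr1.
by rewrite sum_gibbs.
Qed.

(** Normalized so that its expectation is one. *)
Definition gaussian_tilt N (x : R) (s : configuration N) w : R :=
  expR (x * X s w - x ^+ 2 * N%:R / 2).

Lemma has_mean_tilt N (s : configuration N) (x c : R) (U : Omega -> R) :
  (0 < N)%N -> measurable_fun [set: rest_type s] (U : rest_type s -> R) ->
  (forall w, 0 <= U w) -> has_mean P U c ->
  has_mean P (fun w => gaussian_tilt x s w * U w) c.
Proof.
move=> N0 mU U0 [_ Uc]; have NR : 0 < N%:R :> R by rewrite ltr0n.
have mU' : measurable_fun setT U by exact: rest_measurable_fun mU.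
have me : measurable_fun setT (fun y : R => expR (x * y - x ^+ 2 * N%:R / 2)).
  apply: measurableT_comp; first exact: measurable_expR.
  by apply: measurable_funB => //; exact: measurable_funM.
apply: has_mean_ge0.
- by apply: measurable_funM => //; exact: (measurableT_comp me).
- by move=> w; rewrite mulr_ge0 ?expR_ge0.
pose g (z : R * R) := (expR (x * z.1 - x ^+ 2 * N%:R / 2) * `|z.2|)%:E.
transitivity (\int[P]_w g (X s w, U w))%E.
  by apply: eq_integral => w _; rewrite /g/= ger0_norm.
rewrite (rest_integral N0 mU); last 2 first.
- apply/measurable_EFinP; apply: measurable_funM; first exact: (measurableT_comp me).
  exact: measurableT_comp.
- by move=> z; rewrite lee_fin mulr_ge0 ?expR_ge0.
rewrite -Uc; apply: eq_integral => w _; rewrite /g/=.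
under eq_integral do rewrite EFinM.
rewrite ge0_integralZr; last 4 first.
- exact: measurableT.
- exact/measurable_EFinP.
- by move=> y _; rewrite lee_fin expR_ge0.
- by rewrite lee_fin.
rewrite ger0_norm// -[RHS]mul1e; congr (_ * _)%E.
transitivity (\int[normal_prob 0 (Num.sqrt N%:R)]_y
  (expR (x * y - x ^+ 2 * N%:R / 2))%:E)%E.
  apply: integral_borel_copy => [A mA||y]; [exact: X_gauss| |by rewrite lee_fin expR_ge0].
  exact/measurable_EFinP.
under eq_integral do rewrite expRB EFinM.
rewrite ge0_integralZr; last 4 first.
- exact: measurableT.
- by apply/measurable_EFinP; apply: measurableT_comp;
  [exact: measurable_expR|exact: measurable_funM].
- by move=> y _; rewrite lee_fin expR_ge0.
- by rewrite lee_fin invr_ge0 expR_ge0.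
by rewrite normal_mgf// -EFinM divff// gt_eqF// expR_gt0.
Qed.

Lemma weak_law_tanh2 : exists V, forall N e, (0 < N)%N -> 0 < e ->
  fine (P [set w | N%:R * e <= `|\sum_(i < N) tanh (t * h i w) ^+ 2 - N%:R * q|])
   <= V / (N%:R * e ^+ 2).
Proof.
apply: (weak_law_dominated (f := fun x => tanh (t * x) ^+ 2) (K := 1)) => //.
- by apply: measurable_funX; exact: measurable_tanhM.
- by move=> x; exact: sqr_ge0.
move=> x; rewrite mul1r.
have := tanh_sqr_le1 (t * x); have := sqr_ge0 (tanh (t * x)); have := sqr_ge0 x; nra.
Qed.

Lemma measurable_tilted_weight d' (T : measurableType d') N (g : nat -> T -> R)
  (s : configuration N) :
  (forall i, measurable_fun setT (g i)) ->
  measurable_fun setT (fun w => tilted_weight (fun i : 'I_N => t * g i w) s).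
Proof.
move=> mg; under eq_fun do rewrite tilted_weight_expR.
apply: measurableT_comp; first exact: measurable_expR.
apply: measurable_funB.
  by apply: measurable_sum => i; apply: measurable_funM => //; exact: measurable_funM.
apply: measurable_funD => //; apply: measurable_sum => i.
exact: (measurableT_comp (measurable_ln_cosh t)).
Qed.

Lemma rest_measurable_tilted N (s0 s : configuration N) :
  measurable_fun [set: rest_type s0]
    ((fun w => tilted_weight (fun i : 'I_N => t * h i w) s) : rest_type s0 -> R).
Proof.
apply: (@measurable_tilted_weight _ (rest_type s0) N (fun i => h i)) => i.
exact: rest_measurable_h.
Qed.

Lemma has_mean_tilt2 N (s s' : configuration N) (c : R) (U : Omega -> R) :
  (0 < N)%N -> s != s' ->
  measurable_fun [set: rest_type s] (U : rest_type s -> R) ->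
  measurable_fun [set: rest_type s'] (U : rest_type s' -> R) ->
  (forall w, 0 <= U w) -> has_mean P U c ->
  has_mean P (fun w => gaussian_tilt t s w * (gaussian_tilt t s' w * U w)) c.
Proof.
move=> N0 ss' mU mU' U0 Uc; apply: has_mean_tilt => //.
- apply: measurable_funM => //; apply: measurableT_comp; first exact: measurable_expR.
  apply: measurable_funB => //; apply: measurable_funM => //.
  by apply: rest_measurable_X; rewrite eq_sym.
- by move=> w; rewrite mulr_ge0 ?expR_ge0.
- exact: has_mean_tilt.
Qed.

(** On the good event each Gibbs weight is at most
    [e^((t + 1) dl N)] times [gaussian_tilt t s] times the tilted weight of [s].
    The Gaussian factors of two distinct configurations average out to one, and
    [overlap_tail] beats the exponential prefactor as soon as [dl] is small. *)
Lemma off_diagonal_overlap (eps : R) : 0 < eps -> exists C, forall N, (0 < N)%N ->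
  \sum_(p : configuration N * configuration N |
       (p.1 != p.2) && (eps < `|overlap R p.1 p.2 - q|))
    fine (gibbs2_mean X h beta p) <= C / N%:R.
Proof.
move=> eps0.
(* [la] is the Chernoff parameter: the exponent in [overlap_tail] is then at
   most [- la eps / 2], and [dl] is such that the prefactor costs at most half
   of it *)
pose la := Num.min (1 / 2) (eps / 8).
have [la0 la2 la8] : [/\ 0 < la, la <= 1 / 2 & la <= eps / 8].
  by rewrite /la lt_min !divr_gt0// !ge_min !lexx orbT.
pose dl := Num.min (eps / 4) (la * eps / (8 * (t + 1))).
have t1 : 0 < t + 1 by rewrite addr_gt0.
have [dl0 dl4 dl8] : [/\ 0 < dl, dl <= eps / 4 & dl <= la * eps / (8 * (t + 1))].
  rewrite /dl lt_min divr_gt0// divr_gt0 ?mulr_gt0//.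
  by rewrite !ge_min !lexx orbT.
have dlt : 2 * ((t + 1) * dl) <= la * eps / 4.
  move: dl8; rewrite ler_pdivlMr ?mulr_gt0//; lra.
have [C1 H1] := ground_state dl0.
have [V2 H2] := weak_law_ln_cosh.
have [V3 H3] := weak_law_tanh2.
exists (C1 + (V2 + V3) / dl ^+ 2 + 8 / (la * eps)) => N N0.
have NR : 0 < N%:R :> R by rewrite ltr0n.
pose M := N%:R * (t + a - dl).
pose E1 := [set w | forall s : configuration N, hamiltonian X h w s < M].
pose E2 := [set w | N%:R * dl <= `|\sum_(i < N) ln (cosh (t * h i w)) - N%:R * lam|].
pose E3 := [set w | N%:R * dl <= `|\sum_(i < N) tanh (t * h i w) ^+ 2 - N%:R * q|].
have mh C : sigma_family [set: nat] (fun i : nat => h i : Omega -> R) C -> measurable C.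
  exact: sigma_family_measurable.
have s2 : sigma_family [set: nat] (fun i : nat => h i : Omega -> R) E2.
  by apply: (sigma_h_dist (f := fun x => ln (cosh (t * x)))); exact: measurable_ln_cosh.
have s3 : sigma_family [set: nat] (fun i : nat => h i : Omega -> R) E3.
  apply: (sigma_h_dist (f := fun x => tanh (t * x) ^+ 2)).
  by apply: measurable_funX; exact: measurable_tanhM.
pose far (p : configuration N * configuration N) :=
  (p.1 != p.2) && (eps < `|overlap R p.1 p.2 - q|).
pose tw w (s : configuration N) := tilted_weight (fun i : 'I_N => t * h i w) s.
pose W (p : configuration N * configuration N) w := \1_(~` E3) w * (tw w p.1 * tw w p.2).
have W0 p w : 0 <= W p w by rewrite mulr_ge0// mulr_ge0// ltW// tilted_weight_gt0.
have mW p (s : configuration N) : measurable_fun [set: rest_type s]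
  (W p : rest_type s -> R).
  apply: measurable_funM; last first.
    by apply: measurable_funM;
      [exact: (@rest_measurable_tilted N s p.1)|exact: (@rest_measurable_tilted N s p.2)].
  apply: (@measurable_indic _ (rest_type s)).
  apply: measurableC; apply: (@measurable_ge _ _ (rest_type s)).
  apply: measurableT_comp => //; apply: measurable_funB => //.
  apply: measurable_sum => i; apply: measurable_funX.
  by apply: (measurableT_comp (measurable_tanhM t)); exact: rest_measurable_h.
have W1 p : exists c, has_mean P (W p) c.
  apply: (@has_mean_dominated _ _ _ _ _ (fun=> 1) 1); last exact: has_mean_cst.
    exact: (rest_measurable_fun (mW p p.1)).
  move=> w; rewrite ger0_norm// /W mulr_ile1//.
  - by rewrite mulr_ge0// ltW// tilted_weight_gt0.
  - by rewrite mulr_ile1 ?tilted_weight_le1// ltW// tilted_weight_gt0.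
have {W1} [c Wc] : exists c : configuration N * configuration N -> R, forall p, has_mean
  P (W p) (c p).
  by exists (fun p => projT1 (cid (W1 p))) => p; case: cid.
have tailW : \sum_(p | far p) c p <=
    2 * expR (N%:R * (2 * la ^+ 2 + la * dl - la * eps)).
  have mS : has_mean P (fun w => \sum_(p | far p) W p w) (\sum_(p | far p) c p).
    by apply: has_mean_sum => p _; exact: Wc.
  apply: (has_mean_le mS (has_mean_cst P _)) => w.
  have [Ew|Ew] := pselect (E3 w).
    rewrite big1 => [|p _]; first by rewrite mulr_ge0 ?expR_ge0.
    by rewrite /W indicE memNset ?mul0r// => /(_ Ew).
  have hq : `|\sum_(i < N) tanh (t * h i w) ^+ 2 - N%:R * q| <= N%:R * dl.
    by move/negP: Ew; rewrite -ltNge => /ltW.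
  apply: le_trans (overlap_tail eps N0 hq (ltW la0) la2).
  rewrite [leLHS]big_mkcond [leRHS]big_mkcond; apply: ler_sum => p _.
  rewrite /far; case: (p.1 != p.2) => /=; last first.
    by case: ifP => // _; rewrite mulr_ge0// ltW// tilted_weight_gt0.
  case: ifP => // _; rewrite /W indicE; case: (_ \in _); rewrite ?mul1r// mul0r.
  by rewrite mulr_ge0// ltW// tilted_weight_gt0.
pose B := expR ((t + 1) * dl * N%:R).
have mL : has_mean P (fun w => \sum_(p | far p) gibbs X h beta w p.1 * gibbs X h beta w p.2)
    (\sum_(p | far p) fine (gibbs2_mean X h beta p)).
  by apply: has_mean_sum => p _; exact: has_mean_gibbs2.
have mE1 : measurable E1 by exact: measurable_all_below.
have mR : has_mean P (fun w => \1_E1 w + \1_E2 w + \1_E3 w + B ^+ 2 *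
      \sum_(p | far p) gaussian_tilt t p.1 w * (gaussian_tilt t p.2 w * W p w))
    (fine (P E1) + fine (P E2) + fine (P E3) + B ^+ 2 * \sum_(p | far p) c p).
  apply: has_meanD.
    by do 2 ?apply: has_meanD; apply: has_mean_indic => //; exact: mh.
  apply: has_meanZ; apply: has_mean_sum => p /andP[p12 _].
  by apply: has_mean_tilt2 => //; exact: Wc.
have : \sum_(p | far p) fine (gibbs2_mean X h beta p) <=
    fine (P E1) + fine (P E2) + fine (P E3) + B ^+ 2 * \sum_(p | far p) c p.
  apply: (has_mean_le mL mR) => w.
  set S := \sum_(p | far p) gaussian_tilt _ _ _ * _.
  have S0 : 0 <= B ^+ 2 * S.
    rewrite mulr_ge0 ?sqr_ge0// sumr_ge0// => p _.
    by rewrite mulr_ge0 ?expR_ge0// mulr_ge0 ?expR_ge0.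
  have i0 (E : set Omega) : 0 <= \1_E w :> R by rewrite indicE.
  have le1 : \sum_(p | far p) gibbs X h beta w p.1 * gibbs X h beta w p.2 <= 1.
    apply: (@le_trans _ _ (\sum_(p : configuration N * configuration N)
        gibbs X h beta w p.1 * gibbs X h beta w p.2)).
      rewrite [leLHS]big_mkcond; apply: ler_sum => p _; case: ifP => // _.
      by rewrite mulr_ge0 ?gibbs_ge0.
    by rewrite sum_gibbs2.
  have [E1w|nE1] := pselect (E1 w).
    have : \1_E1 w = 1 :> R by rewrite indicE mem_set.
    by have := i0 E2; have := i0 E3; lra.
  have [E2w|nE2] := pselect (E2 w).
    have : \1_E2 w = 1 :> R by rewrite indicE mem_set.
    by have := i0 E1; have := i0 E3; lra.
  have [E3w|nE3] := pselect (E3 w).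
    have : \1_E3 w = 1 :> R by rewrite indicE mem_set.
    by have := i0 E1; have := i0 E2; lra.
  suff : \sum_(p | far p) gibbs X h beta w p.1 * gibbs X h beta w p.2 <= B ^+ 2 * S.
    by have := i0 E1; have := i0 E2; have := i0 E3; lra.
  have [s0 Ms0] : exists s0 : configuration N, M <= hamiltonian X h w s0.
    apply: contrapT => no; apply: nE1 => s; rewrite ltNge; apply/negP => Ms.
    by apply: no; exists s.
  move/negP: nE2; rewrite -ltNge ltr_norml => /andP[_ nE2].
  have bound (s : configuration N) : gibbs X h beta w s <= B *
    (gaussian_tilt t s w * tw w s).
    apply: (le_trans (gibbs_le_exp s Ms0)).
    rewrite /tw tilted_weight_expR /B /gaussian_tilt -!expRD ler_expR.
    have -> : \sum_(i < N) t * h i w * spin R s i = t * \sum_(i < N) h i w * spin R s i.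
      by rewrite mulr_sumr; apply: eq_bigr => i _; rewrite mulrA.
    rewrite /hamiltonian; set Y := \sum_(i < N) _ * _; set L := \sum_(i < N) _.
    have : t * M = N%:R * (t ^+ 2 / 2 + ln 2 + lam) - t * (N%:R * dl).
      have -> : lam = t ^+ 2 / 2 + t * a - ln 2 by rewrite crit; ring.
      by rewrite /M; field.
    by move: nE2; rewrite -/L; lra.
  rewrite /S mulr_sumr; apply: ler_sum => p _.
  rewrite /W indicE mem_set// mul1r.
  apply: (le_trans (ler_pM (gibbs_ge0 _ _ _ _ _) (gibbs_ge0 _ _ _ _ _) (bound p.1)
    (bound p.2))).
  by rewrite le_eqVlt; apply/orP; left; apply/eqP; ring.
move=> /le_trans; apply.
rewrite mulrDl; apply: lerD; last first.
  apply: (@le_trans _ _ (B ^+ 2 * (2 * expR (N%:R * (2 * la ^+ 2 + la * dl - la * eps))))).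
    by rewrite ler_wpM2l ?sqr_ge0.
  rewrite mulrCA /B -expRM_natr -expRD.
  apply: (@le_trans _ _ (2 * expR (- (la * eps / 4 * N%:R)))).
    rewrite ler_pM2l// ler_expR.
    have : 2 * la ^+ 2 + la * dl <= la * eps / 2 by nra.
    move=> k; have := ler_wpM2l (ltW NR) k; have := ler_wpM2l (ltW NR) dlt; lra.
  rewrite expRN.
  have -> : 8 / (la * eps) / N%:R = 2 * (la * eps / 4 * N%:R)^-1.
    by field; rewrite !gt_eqF.
  rewrite ler_pM2l// lef_pV2 ?posrE ?expR_gt0//;
    last by rewrite mulr_gt0// divr_gt0// mulr_gt0.
  by apply: le_trans (expR_ge1Dx _); rewrite lerDr.
rewrite -addrA mulrDl; apply: lerD; first exact: H1.
have -> : (V2 + V3) / dl ^+ 2 / N%:R = V2 / (N%:R * dl ^+ 2) + V3 / (N%:R * dl ^+ 2).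
  by field; rewrite !gt_eqF.
by apply: lerD; [exact: H2|exact: H3].
Qed.

(** ** Two equal samples *)

(** The Gibbs average of the Gaussian part of the Hamiltonian. *)
Definition gaussian_energy N w := \sum_(s : configuration N) gibbs X h beta w s * X s w.

Lemma gaussian_energy_le N x w : x * gaussian_energy N w <=
  ln (\sum_(s : configuration N) expR (beta * hamiltonian X h w s + x * X s w))
  - ln (partition_function X h beta N w).
Proof.
apply: le_trans (log_sum_exp_tangent [ffun=> true] _ _).
rewrite /gaussian_energy mulr_sumr le_eqVlt; apply/orP; left; apply/eqP.
by apply: eq_bigr => s _; rewrite mulrCA.
Qed.

(** The [m]-th power of the partition function, bounded term by term and divided
    by its exponential order. *)
Definition tilt_sum N y w := \sum_(s : configuration N)
  gaussian_tilt y s w * tilted_weight (fun i : 'I_N => t * h i w) s.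

Lemma has_mean_tilt_sum N y : (0 < N)%N -> has_mean P (tilt_sum N y) 1.
Proof.
move=> N0; pose tw (s : configuration N) w := tilted_weight (fun i : 'I_N => t * h i w) s.
have tw0 s w : 0 <= tw s w by exact/ltW/tilted_weight_gt0.
have mtw s : measurable_fun setT (tw s).
  by apply: (measurable_tilted_weight (g := fun i => h i)).
have ex s : exists c, has_mean P (tw s) c.
  apply: (@has_mean_dominated _ _ _ _ _ (fun=> 1) 1 (mtw s)); last exact: has_mean_cst.
  by move=> w; rewrite ger0_norm// tilted_weight_le1.
have [c twc] : exists c : configuration N -> R, forall s, has_mean P (tw s) (c s).
  by exists (fun s => projT1 (cid (ex s))) => s; case: cid.
have c1 : \sum_s c s = 1.
  have cs : has_mean P (fun w => \sum_s tw s w) (\sum_s c s) by apply: has_mean_sum => s _.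
  apply: (has_mean_unique cs); apply: (has_mean_eq _ (has_mean_cst P 1)) => w.
  by rewrite sum_tilted_weight.
rewrite -c1; apply: has_mean_sum => s _.
exact: (has_mean_tilt y N0
  (@rest_measurable_tilted N s s) (tw0 s) (twc s)).
Qed.

(** Combine [expR_ln_sum_le] with [1 + u <= e^u]. *)
Lemma log_partition_le N x w :
  t / beta * ln (\sum_(s : configuration N) expR
    (beta * hamiltonian X h w s + x * X s w)) <=
  tilt_sum N (t + t / beta * x) w - 1 + (N%:R * (t + t / beta * x) ^+ 2 / 2 +
   (N%:R * ln 2 + \sum_(i < N) ln (cosh (t * h i w)))).
Proof.
set y := t + _; set L := N%:R * ln 2 + _; set Z := ln _.
have m1 : t / beta <= 1 by rewrite ler_pdivrMr// mul1r ltW.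
have key : expR (t / beta * Z) <= tilt_sum N y w * expR (N%:R * y ^+ 2 / 2 + L).
  apply: (le_trans (expR_ln_sum_le [ffun=> true] _ m1)).
  rewrite /tilt_sum mulr_suml; apply: ler_sum => s _.
  rewrite tilted_weight_expR /gaussian_tilt -!expRD ler_expR /hamiltonian.
  have -> : \sum_(i < N) t * h i w * spin R s i = t * \sum_(i < N) h i w * spin R s i.
    by rewrite mulr_sumr; apply: eq_bigr => i _; rewrite mulrA.
  rewrite -/L /y le_eqVlt; apply/orP; left; apply/eqP.
  by field; rewrite gt_eqF.
rewrite -lerBlDr; apply: (@le_trans _ _
  (expR (t / beta * Z - (N%:R * y ^+ 2 / 2 + L)) - 1)).
  by rewrite lerBrDl expR_ge1Dx.
by rewrite lerD2r expRB ler_pdivrMr ?expR_gt0.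
Qed.

(** On the exceptional event only the energy of one fixed configuration bounds the
    partition function from below; it is split by Young's inequality with
    parameter [K], so that the error is controlled by [K] times the probability of
    the event and by second moments divided by [K]. *)
Lemma log_partition_ge N (M K : R) w : (0 < N)%N -> 0 < K ->
  beta * M - beta * ((`|M| + K * N%:R) *
      \1_[set w | forall s : configuration N, hamiltonian X h w s < M] w
    + (X ([ffun=> true] : configuration N) w ^+ 2 / (2 * K * N%:R) +
       \sum_(i < N) h i w ^+ 2 / (2 * K))) <=
  ln (partition_function X h beta N w).
Proof.
move=> N0 K0; have NR : 0 < N%:R :> R by rewrite ltr0n.
pose s0 : configuration N := [ffun=> true]; rewrite -/s0.
set B := [set w | _].
have lnZ (s : configuration N) : beta * hamiltonian X h w s <= ln
  (partition_function X h beta N w).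
  rewrite -[leLHS]expRK ler_ln ?posrE ?expR_gt0 ?partition_function_gt0//.
  rewrite /partition_function (bigD1 s)//= lerDl.
  by apply: sumr_ge0 => s' _; exact: expR_ge0.
have Q0 : 0 <= X s0 w ^+ 2 / (2 * K * N%:R) by rewrite divr_ge0 ?sqr_ge0// !mulr_ge0// ltW.
have Q1 : 0 <= \sum_(i < N) h i w ^+ 2 / (2 * K).
  by apply: sumr_ge0 => i _; rewrite divr_ge0 ?sqr_ge0// mulr_ge0// ltW.
rewrite -mulrBr.
have [Bw|nB] := pselect (B w); last first.
  have [s Ms] : exists s : configuration N, M <= hamiltonian X h w s.
    apply: contrapT => no; apply: nB => s; rewrite ltNge; apply/negP => Ms.
    by apply: no; exists s.
  apply: le_trans (lnZ s); rewrite ler_pM2l//; apply: le_trans Ms.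
  by rewrite indicE memNset// mulr0; lra.
apply: le_trans (lnZ s0); rewrite ler_pM2l// indicE mem_set// mulr1.
have young (x c : R) : 0 < c -> - x <= x ^+ 2 / (2 * c) + c / 2.
  move=> c0; have -> : x ^+ 2 / (2 * c) + c / 2 = (x + c) ^+ 2 / (2 * c) - x.
    by field; rewrite gt_eqF.
  by rewrite lerDr divr_ge0 ?sqr_ge0// mulr_ge0// ltW.
have := ler_norm M.
have : - X s0 w <= X s0 w ^+ 2 / (2 * K * N%:R) + K * N%:R / 2.
  by rewrite -[2 * K * _]mulrA; apply: young; rewrite mulr_gt0.
have : - \sum_(i < N) h i w * spin R s0 i <= \sum_(i < N) h i w ^+ 2 / (2 * K) + K *
  N%:R / 2.
  have -> : K * N%:R / 2 = \sum_(i < N) (K / 2).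
    by rewrite sumr_const card_ord -[RHS]mulr_natr; ring.
  rewrite -sumrN -big_split/=; apply: ler_sum => i _.
  by rewrite /spin ffunE mulr1; exact: young.
by rewrite /hamiltonian; lra.
Qed.

Lemma has_mean_sqr_energy N (s : configuration N) : (0 < N)%N ->
  exists2 g, has_mean P (fun w => X s w ^+ 2) g & g <= 4 * expR (1 / 2) * N%:R.
Proof.
move=> N0; have NR : 0 < N%:R :> R by rewrite ltr0n.
have I : (\int[P]_w (X s w ^+ 2)%:E <= (4 * expR (1 / 2) * N%:R)%:E)%E.
  rewrite (integral_law P (X s) (f := fun x => x ^+ 2)); last 2 first.
  - exact: measurable_funX.
  - by move=> x; exact: sqr_ge0.
  apply: le_trans (normal_second_moment_le NR); rewrite le_eqVlt; apply/orP; left;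
    apply/eqP.
  apply: integral_borel_copy => [A mA||x]; [exact: X_gauss| |by rewrite lee_fin sqr_ge0].
  by apply/measurable_EFinP; exact: measurable_funX.
have I0 : (0 <= \int[P]_w (X s w ^+ 2)%:E)%E.
  by apply: integral_ge0 => w _; rewrite lee_fin sqr_ge0.
have If : (\int[P]_w (X s w ^+ 2)%:E)%E \is a fin_num.
  by rewrite ge0_fin_numE//; apply: le_lt_trans I _; rewrite ltry.
exists (fine (\int[P]_w (X s w ^+ 2)%:E)).
  apply: has_mean_ge0; [exact: measurable_funX|by move=> w; exact: sqr_ge0|].
  by rewrite fineK.
by rewrite -lee_fin fineK.
Qed.

(** Apply the convexity bound [gaussian_energy_le] at [x = eps] and [x = - eps].
    For large [N] the expectation of its right-hand side is at most
    [N (t x + eps^2)]: the choice of [t] makes the terms of order zero cancel. *)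
Lemma gaussian_energy_density (eps : R) : 0 < eps -> exists N0, forall N, (N0 <= N)%N ->
  (0 < N)%N ->
  forall e, has_mean P (gaussian_energy N) e -> `|e / N%:R - t| <= eps.
Proof.
move=> eps0.
have v20 : 0 <= v2.
  by apply: (has_mean_le (has_mean_cst P 0) Hv) => w; exact: sqr_ge0.
(* [dl] and [K] each cost [eps^2 / 8] per site, and [D] collects what does not
   grow with [N] *)
pose dl := eps ^+ 2 / (8 * beta).
pose K := 4 * beta * v2 / eps ^+ 2 + 1.
have e20 : 0 < eps ^+ 2 by rewrite exprn_gt0.
have dl0 : 0 < dl by rewrite divr_gt0// mulr_gt0.
have K0 : 0 < K.
  by rewrite ltr_wpDl// divr_ge0 ?(ltW e20)// mulr_ge0// mulr_ge0// ltW.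
have dlE : beta * dl = eps ^+ 2 / 8 by rewrite /dl; field; rewrite gt_eqF.
have KE : beta * (v2 / (2 * K)) <= eps ^+ 2 / 8.
  rewrite mulrA ler_pdivrMr ?mulr_gt0// /K.
  have -> : eps ^+ 2 / 8 * (2 * (4 * beta * v2 / eps ^+ 2 + 1)) = beta * v2 + eps ^+ 2 / 4.
    by field; rewrite gt_eqF.
  by rewrite lerDl divr_ge0// ltW.
have [C HC] := ground_state dl0.
pose D := beta * ((`|t + a - dl| + K) * C + 4 * expR (1 / 2) / (2 * K)).
exists (Num.truncn (4 * D / eps ^+ 2)).+1 => N NN0 N0 e He.
have NR : 0 < N%:R :> R by rewrite ltr0n.
have DN : D <= N%:R * (eps ^+ 2 / 4).
  rewrite -ler_pdivrMr ?divr_gt0//.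
  have -> : D / (eps ^+ 2 / 4) = 4 * D / eps ^+ 2 by field; rewrite gt_eqF.
  by rewrite ltW// (lt_le_trans (truncnS_gt _))// ler_nat.
pose s0 : configuration N := [ffun=> true].
have [g Hg gN] := has_mean_sqr_energy s0 N0.
pose M := N%:R * (t + a - dl).
pose B := [set w | forall s : configuration N, hamiltonian X h w s < M].
have PB : fine (P B) <= C / N%:R by exact: HC.
have bound x : x ^+ 2 = eps ^+ 2 -> x * e <= N%:R * (t * x + eps ^+ 2).
  move=> xe; pose y := t + t / beta * x.
  have mUp : has_mean P (fun w => beta / t * (tilt_sum N y w - 1 + (N%:R * y ^+ 2 / 2 +
      (N%:R * ln 2 + \sum_(i < N) ln (cosh (t * h i w))))))
    (beta / t * (1 - 1 + (N%:R * y ^+ 2 / 2 + (N%:R * ln 2 + \sum_(i < N) lam)))).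
    apply: has_meanZ; apply: has_meanD.
      by apply: has_meanB; [exact: has_mean_tilt_sum|exact: has_mean_cst].
    apply: has_meanD; first exact: has_mean_cst.
    apply: has_meanD; first exact: has_mean_cst.
    apply: has_mean_sum => i _.
    apply: (has_mean_ident h_ident i (f := fun x => ln (cosh (t * x)))) => //.
      exact: measurable_ln_cosh.
    by move=> z; exact: ln_cosh_ge0.
  have mLo : has_mean P (fun w => beta * M - beta * ((`|M| + K * N%:R) * \1_B w
    + (X s0 w ^+ 2 / (2 * K * N%:R) + \sum_(i < N) h i w ^+ 2 / (2 * K))))
    (beta * M - beta * ((`|M| + K * N%:R) * fine (P B)
    + ((2 * K * N%:R)^-1 * g + \sum_(i < N) (2 * K)^-1 * v2))).
    apply: has_meanB; first exact: has_mean_cst.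
    apply: has_meanZ; apply: has_meanD.
      by apply: has_meanZ; apply: has_mean_indic; exact: measurable_all_below.
    apply: has_meanD.
      by apply: (has_mean_eq _ (has_meanZ _ Hg)) => w; rewrite mulrC.
    apply: has_mean_sum => i _.
    have Hi := has_mean_ident h_ident i (measurable_funX 2 (@measurable_id _ _ _))
      (fun x => sqr_ge0 x) Hv.
    by apply: (has_mean_eq _ (has_meanZ _ Hi)) => w; rewrite mulrC.
  apply: (le_trans (has_mean_le (has_meanZ x He) (has_meanB mUp mLo) _)).
    move=> w; apply: le_trans (gaussian_energy_le N x w) _.
    apply: lerB; last exact: log_partition_ge.
    have bt : beta / t * (t / beta) = 1 by field; rewrite !gt_eqF.
    have := ler_wpM2l (ltW (divr_gt0 beta0 t0)) (log_partition_le N x w).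
    by rewrite (mulrA (beta / t) (t / beta)) bt mul1r.
  rewrite !sumr_const card_ord -[lam *+ N]mulr_natl -[(_ * v2) *+ N]mulr_natl.
  have -> : beta / t * (1 - 1 + (N%:R * y ^+ 2 / 2 + (N%:R * ln 2 + N%:R * lam))) =
      N%:R * (beta * (t + a) + t * x + t / beta * (x ^+ 2 / 2)).
    have -> : lam = t ^+ 2 / 2 + t * a - ln 2 by rewrite crit; ring.
    by rewrite /y; field; rewrite !gt_eqF.
  have h1 : (`|M| + K * N%:R) * fine (P B) <= (`|t + a - dl| + K) * C.
    have -> : `|M| + K * N%:R = N%:R * (`|t + a - dl| + K).
      by rewrite /M normrM (ger0_norm (ltW NR)); ring.
    have -> : (`|t + a - dl| + K) * C = N%:R * (`|t + a - dl| + K) * (C / N%:R).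
      by field; rewrite gt_eqF.
    by rewrite ler_wpM2l// mulr_ge0 ?(ltW NR)// addr_ge0// ltW.
  have h2 : (2 * K * N%:R)^-1 * g <= 4 * expR (1 / 2) / (2 * K).
    rewrite mulrC ler_pdivrMr ?mulr_gt0//; apply: le_trans gN _.
    by rewrite le_eqVlt; apply/orP; left; apply/eqP; field; rewrite gt_eqF.
  have h3 : t / beta * (x ^+ 2 / 2) <= eps ^+ 2 / 2.
    by rewrite xe ler_piMl ?divr_ge0 ?(ltW e20)// ler_pdivrMr// mul1r ltW.
  have h4 : beta * ((2 * K)^-1 * v2) <= eps ^+ 2 / 8 by rewrite [_^-1 * _]mulrC.
  have {h1 h2} h12 := ler_wpM2l (ltW beta0) (lerD h1 h2).
  rewrite -/D in h12.
  have h34 := ler_wpM2l (ltW NR) (lerD h3 h4).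
  have hdl : beta * M = N%:R * (beta * (t + a)) - N%:R * (eps ^+ 2 / 8).
    by rewrite -dlE /M; ring.
  by rewrite hdl; lra.
have := bound eps erefl; have := bound (- eps) (sqrrN _).
have -> : N%:R * (t * - eps + eps ^+ 2) = eps * (N%:R * (eps - t)) by ring.
have -> : N%:R * (t * eps + eps ^+ 2) = eps * (N%:R * (eps + t)) by ring.
rewrite mulNr -mulrN !ler_pM2l// => h1 h2.
rewrite ler_norml lerBrDr lerBlDr ler_pdivlMr// ler_pdivrMr//.
by apply/andP; split; lra.
Qed.

(** The contribution of all other configurations to the partition function,
    divided by the field weight of [s]. *)
Definition field_ratio N (s : configuration N) w :=
  (\sum_(s' | s' != s) expR (beta * hamiltonian X h w s')) *
  expR (- (beta * \sum_(i < N) h i w * spin R s i)).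

Lemma gibbs_logistic N (s : configuration N) w :
  gibbs X h beta w s = logistic beta (X s w) (field_ratio s w).
Proof.
rewrite /logistic ger0_norm; last first.
  by rewrite mulr_ge0 ?expR_ge0// sumr_ge0// => s' _; exact: expR_ge0.
rewrite /gibbs /partition_function (bigD1 s)//= /field_ratio.
set V := \sum_(_ | _) _.
have V0 : 0 <= V by apply: sumr_ge0 => s' _; exact: expR_ge0.
have -> : expR (- (beta * \sum_(i < N) h i w * spin R s i)) =
    expR (beta * X s w) / expR (beta * hamiltonian X h w s).
  by rewrite -expRB /hamiltonian; congr expR; ring.
have -> : expR (- beta * X s w) = (expR (beta * X s w))^-1 by rewrite mulNr expRN.
set E := expR (beta * hamiltonian _ _ _ _); have E0 : 0 < E by exact: expR_gt0.
have E1 := expR_gt0 (beta * X s w).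
by field; rewrite !gt_eqF// ltr_pwDl.
Qed.

Lemma rest_measurable_field_ratio N (s : configuration N) :
  measurable_fun [set: rest_type s] (field_ratio s : rest_type s -> R).
Proof.
have mY (s' : configuration N) : measurable_fun [set: rest_type s]
    ((fun w => \sum_(i < N) h i w * spin R s' i) : rest_type s -> R).
  apply: measurable_sum => i; apply: measurable_funM => //.
  exact: rest_measurable_h.
apply: measurable_funM; last first.
  apply: measurableT_comp; first exact: measurable_expR.
  by apply: measurableT_comp => //; apply: measurable_funM.
rewrite (_ : (fun w => _) = (fun w => \sum_(s' : configuration N)
    (if s' == s then 0 else expR (beta * hamiltonian X h w s')))); last first.
  by apply/funext => w; rewrite big_mkcond/=; apply: eq_bigr => s' _; case: eqP.
apply: measurable_sum => s'; have [//|ss'] := eqVneq s' s.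
apply: measurableT_comp; first exact: measurable_expR.
apply: measurable_funM => //; apply: measurable_funD => //.
exact: rest_measurable_X.
Qed.

(** Integrate out [X s] first, by [rest_integral]: given the rest of the disorder
    the Gibbs weight of [s] is a logistic function of [X s], whose derivative is
    [beta G (1 - G)], and [logistic_ibp] applies. *)
Lemma has_mean_gibbs_energy N (s : configuration N) : (0 < N)%N ->
  exists2 g, has_mean P (fun w => gibbs X h beta w s) g &
    has_mean P (fun w => gibbs X h beta w s * X s w)
      (beta * N%:R * (g - fine (gibbs2_mean X h beta (s, s)))).
Proof.
move=> N0; have NR : 0 < N%:R :> R by rewrite ltr0n.
pose G w := gibbs X h beta w s.
have mG : measurable_fun setT G by exact: measurable_gibbs.
have G0 w : 0 <= G w by exact: gibbs_ge0.
have G1 w : G w <= 1 by exact: gibbs_le1.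
have [g Hg] : exists g, has_mean P G g.
  apply: (@has_mean_dominated _ _ _ _ _ (fun=> 1) 1 mG); last exact: has_mean_cst.
  by move=> w; rewrite ger0_norm.
exists g => //.
have Hd := has_mean_gibbs2 (s, s).
have [x2 Hx2 _] := has_mean_sqr_energy s N0.
have maxX (x : R) : 0 <= Num.max x 0 <= 1 + x ^+ 2.
  by rewrite le_max lexx orbT ge_max addr_ge0 ?sqr_ge0// andbT /=;
    have := sqr_ge0 (x - 1); nra.
have H1X := has_meanD (has_mean_cst P 1) Hx2.
have mX : measurable_fun setT (X s) by [].
have mXp : measurable_fun setT (fun w => Num.max (X s w) 0 * G w).
  by apply: measurable_funM => //; exact: measurable_maxr.
have mXn : measurable_fun setT (fun w => Num.max (- X s w) 0 * G w).
  by apply: measurable_funM => //; apply: measurable_maxr => //; exact: measurableT_comp.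
have [p Hp] : exists p, has_mean P (fun w => Num.max (X s w) 0 * G w) p.
  apply: (has_mean_dominated mXp _ H1X) => w.
  have /andP[m0 m1] := maxX (X s w).
  by rewrite ger0_norm; [apply: le_trans m1; rewrite ler_piMr|exact: (mulr_ge0 m0 (G0 w))].
have [n Hn] : exists n, has_mean P (fun w => Num.max (- X s w) 0 * G w) n.
  apply: (has_mean_dominated mXn _ H1X) => w.
  have /andP[m0] := maxX (- X s w); rewrite sqrrN => m1.
  by rewrite ger0_norm; [apply: le_trans m1; rewrite ler_piMr|exact: (mulr_ge0 m0 (G0 w))].
have Hr : has_mean P (fun w => Num.max (- X s w) 0 * G w + N%:R *
  (beta * (G w * (1 - G w))))
   (n + N%:R * (beta * (g - fine (gibbs2_mean X h beta (s, s))))).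
  apply: has_meanD => //; do 2 apply: has_meanZ.
  by apply: (has_mean_eq _ (has_meanB Hg Hd)) => w; rewrite -/(G w) /=; ring.
have ibp : (\int[P]_w (Num.max (X s w) 0 * G w)%:E =
    \int[P]_w (Num.max (- X s w) 0 * G w + N%:R * (beta * (G w * (1 - G w))))%:E)%E.
  pose L (z : R * R) := logistic beta z.1 z.2.
  have mL : measurable_fun setT L by exact: measurable_logistic.
  have L0 z : 0 <= L z by exact: logistic_ge0.
  have L1 z : L z <= 1 by exact: logistic_le1.
  have LL z : 0 <= L z * (1 - L z) by rewrite mulr_ge0 ?subr_ge0.
  pose g1 (z : R * R) := (Num.max z.1 0 * L z)%:E.
  pose g2 (z : R * R) := (Num.max (- z.1) 0 * L z + N%:R * (beta * (L z * (1 - L z))))%:E.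
  have mg1 : measurable_fun setT (fun z : R * R => Num.max z.1 0 * L z).
    by apply: measurable_funM => //; exact: measurable_maxr.
  have mg2 : measurable_fun setT (fun z : R * R =>
      Num.max (- z.1) 0 * L z + N%:R * (beta * (L z * (1 - L z)))).
    apply: measurable_funD.
      apply: measurable_funM => //; apply: measurable_maxr => //.
      exact: measurableT_comp.
    do 2 (apply: measurable_funM => //).
    by apply: measurable_funM => //; exact: measurable_funB.
  have g10 z : 0 <= Num.max z.1 0 * L z by rewrite mulr_ge0// le_max lexx orbT.
  have g20 z : 0 <= Num.max (- z.1) 0 * L z + N%:R * (beta * (L z * (1 - L z))).
    apply: addr_ge0; first by rewrite mulr_ge0// le_max lexx orbT.
    by apply: mulr_ge0 => //; exact: (mulr_ge0 (ltW beta0) (LL z)).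
  transitivity (\int[P]_w g1 (X s w, field_ratio s w))%E.
    by apply: eq_integral => w _; rewrite /g1 /L/= -gibbs_logistic.
  transitivity (\int[P]_w g2 (X s w, field_ratio s w))%E; last first.
    by apply: eq_integral => w _; rewrite /g2 /L/= -gibbs_logistic.
  have mU := @rest_measurable_field_ratio N s.
  rewrite (rest_integral N0 mU); last 2 first.
  - exact/measurable_EFinP.
  - by move=> z; rewrite lee_fin.
  rewrite (rest_integral N0 mU); last 2 first.
  - exact/measurable_EFinP.
  - by move=> z; rewrite lee_fin.
  apply: eq_integral => w _.
  pose gamma : {measure set (measurableTypeR R) -> \bar R} := normal_prob 0 (Num.sqrt N%:R).
  have mpair : measurable_fun setT (fun x : R => (x, field_ratio s w)).
    by apply: measurable_fun_pair.
  rewrite (@integral_borel_copy _ _ gamma); last 3 first.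
  - by move=> A mA; exact: X_gauss.
  - by apply/measurable_EFinP; exact: (measurableT_comp mg1 mpair).
  - by move=> x; rewrite lee_fin.
  rewrite (@integral_borel_copy _ _ gamma); last 3 first.
  - by move=> A mA; exact: X_gauss.
  - by apply/measurable_EFinP; exact: (measurableT_comp mg2 mpair).
  - by move=> x; rewrite lee_fin.
  exact: logistic_ibp.
have pE : p = n + N%:R * (beta * (g - fine (gibbs2_mean X h beta (s, s)))).
  by have [_ Hp2] := Hp; have [_ Hr2] := Hr; apply: EFin_inj; rewrite -Hp2 -Hr2.
have -> : beta * N%:R * (g - fine (gibbs2_mean X h beta (s, s))) = p - n.
  by rewrite pE; ring.
apply: (has_mean_eq _ (has_meanB Hp Hn)) => w; rewrite -/(G w) -mulrBl mulrC.
congr (_ * _).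
by have [x0|x0] := leP 0 (X s w); [rewrite max_r ?subr0|rewrite max_l ?sub0r ?opprK]; lra.
Qed.

(** Sum over [s]; the means of the Gibbs weights add up to one. *)
Lemma gaussian_energy_ibp N : (0 < N)%N ->
  has_mean P (gaussian_energy N)
    (beta * N%:R * (1 - \sum_(s : configuration N) fine (gibbs2_mean X h beta (s, s)))).
Proof.
move=> N0.
have [g Hg] : exists g : configuration N -> R, forall s,
    has_mean P (fun w => gibbs X h beta w s) (g s) /\
    has_mean P (fun w => gibbs X h beta w s * X s w)
      (beta * N%:R * (g s - fine (gibbs2_mean X h beta (s, s)))).
  have ex s := has_mean_gibbs_energy s N0.
  by exists (fun s => projT1 (cid2 (ex s))) => s; case: cid2.
have g1 : \sum_(s : configuration N) g s = 1.
  have Hs : has_mean P (fun w => \sum_(s : configuration N) gibbs X h beta w s)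
      (\sum_(s : configuration N) g s).
    by apply: has_mean_sum => s _; exact: (Hg s).1.
  apply: (has_mean_unique Hs); apply: (has_mean_eq _ (has_mean_cst P 1)) => w.
  by rewrite sum_gibbs.
have -> : 1 - \sum_(s : configuration N) fine (gibbs2_mean X h beta (s, s)) =
    \sum_(s : configuration N) (g s - fine (gibbs2_mean X h beta (s, s))).
  by rewrite sumrB g1.
rewrite mulr_sumr /gaussian_energy.
by apply: has_mean_sum => s _; exact: (Hg s).2.
Qed.

End random_energy_model_in_random_field.

(** * Laws with finite support *)

Section finite_support.
Context {R : realType} (I : finType) (i0 : I) (c : I -> R) (x : I -> R)
  (mu : {measure set (measurableTypeR R) -> \bar R}) (D : set (measurableTypeR R)).
Context (c0 : forall i, 0 <= c i) (mD : measurable D) (xD : forall i, D (x i)).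
Context (muE : forall A : set (measurableTypeR R), measurable A ->
  mu A = (\sum_i (c i)%:E * \d_(x i) A)%E).

Lemma ge0_integral_finite_support (f : R -> R) : measurable_fun D f ->
  (forall y, D y -> 0 <= f y) ->
  (\int[mu]_(y in D) (f y)%:E = (\sum_i c i * f (x i))%:E)%E.
Proof.
move=> mf f0.
have mfE : measurable_fun D (EFin \o f) by exact/measurable_EFinP.
have f0E y : D y -> (0 <= (f y)%:E)%E by move=> /f0; rewrite lee_fin.
pose nn i : {nonneg R} := NngNum (c0 i).
pose m k : {measure set (measurableTypeR R) -> \bar R} :=
  mscale (nn (nth i0 (enum I) k)) \d_(x (nth i0 (enum I) k) : measurableTypeR R).
transitivity (\int[msum m #|I|]_(y in D) (f y)%:E)%E.
  apply: eq_measure_integral => A mA _; rewrite muE// /msum/= /mscale/=.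
  rewrite -big_enum/= (big_nth i0) -cardE big_mkord.
  by apply: eq_bigr.
rewrite ge0_integral_measure_sum//.
rewrite -sumEFin -[RHS]big_enum/= (big_nth i0) -cardE big_mkord.
apply: eq_bigr => k _.
rewrite ge0_integral_mscale// integral_dirac// EFinM diracE mem_set// mul1e.
by [].
Qed.

(** Shift [f] by its bound to reduce to the nonnegative case. *)
Lemma integral_finite_support (f : R -> R) (M : R) : measurable_fun D f ->
  (forall y, D y -> `|f y| <= M) ->
  (\int[mu]_(y in D) (f y)%:E = (\sum_i c i * f (x i))%:E)%E.
Proof.
move=> mf fM.
have M0 : 0 <= M by apply: le_trans (fM _ (xD i0)).
have IM := @ge0_integral_finite_support (fun=> M) (measurable_cst _) (fun _ _ => M0).
have mfM : measurable_fun D (fun y => f y + M) by exact: measurable_funD.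
have fM0 y : D y -> 0 <= f y + M by move=> /fM; rewrite ler_norml; lra.
have IfM := ge0_integral_finite_support mfM fM0.
have iM : mu.-integrable D (EFin \o (fun=> M)).
  apply/integrableP; split; first exact/measurable_EFinP.
  by under eq_integral do rewrite /= ger0_norm//; rewrite IM ltry.
have ifM : mu.-integrable D (EFin \o (fun y => f y + M)).
  apply/integrableP; split; first exact/measurable_EFinP.
  rewrite [ltLHS](_ : _ = \int[mu]_(y in D) (f y + M)%:E)%E; first by rewrite IfM ltry.
  by apply: eq_integral => y; rewrite inE => Dy /=; rewrite ger0_norm// fM0.
transitivity (\int[mu]_(y in D) ((f y + M)%:E - M%:E))%E.
  by apply: eq_integral => y _; rewrite -EFinB addrK.
rewrite integralB_EFin// IfM IM -EFinB -sumrB; congr (_%:E).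
by apply: eq_bigr => i _; ring.
Qed.

End finite_support.

Section two_point_law.
Context {R : realType} (p x y : R) (p01 : 0 <= p <= 1).

Let p0 : 0 <= p. Proof. by case/andP: p01. Qed.
Let r0 : 0 <= 1 - p. Proof. by rewrite subr_ge0; case/andP: p01. Qed.

Definition two_point_law : set (measurableTypeR R) -> \bar R :=
  measure_add (mscale (NngNum p0) \d_(x : measurableTypeR R))
    (mscale (NngNum r0) \d_(y : measurableTypeR R)).

HB.instance Definition _ := Measure.on two_point_law.

Lemma two_point_lawE A :
  two_point_law A = (p%:E * \d_x A + (1 - p)%:E * \d_y A)%E.
Proof. by rewrite /two_point_law measure_addE. Qed.

Let two_point_setT : two_point_law setT = 1%E.
Proof. by rewrite two_point_lawE !diracT !mule1 -EFinD addrC subrK. Qed.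

HB.instance Definition _ :=
  Measure_isProbability.Build _ _ R two_point_law two_point_setT.

End two_point_law.

(** * Convergence of the overlap law *)

Lemma has_mean_expectation {R : realType} d (T : measurableType d) (P : probability T R)
    (f : T -> R) c : has_mean P f c -> fine 'E_P[f] = c.
Proof. by move=> [_ fc]; rewrite unlock fc. Qed.

Lemma square_integrable_of_mgf {R : realType} d (T : measurableType d) (P : probability T R)
    (U : {RV P >-> R}) : (forall u : R, ('M_P U u < +oo)%E) ->
  exists v, has_mean P (fun w => U w ^+ 2) v.
Proof.
move=> MU.
have me u : measurable_fun setT (fun w => expR (u * U w)).
  by apply: measurableT_comp; [exact: measurable_expR|exact: measurable_funM].
have HE u : exists c, has_mean P (fun w => expR (u * U w)) c.
  have := MU u; rewrite /mmt_gen_fun unlock => Mu.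
  have I0 : (0 <= \int[P]_w (expR (u * U w))%:E)%E.
    by apply: integral_ge0 => w _; rewrite lee_fin expR_ge0.
  have Iy : (\int[P]_w (expR (u * U w))%:E < +oo)%E.
    rewrite [ltLHS](_ : _ = \int[P]_w ((expR \o u \o* U) w)%:E)%E//.
    by apply: eq_integral => w _ /=; rewrite mulrC.
  exists (fine (\int[P]_w (expR (u * U w))%:E)); apply: has_mean_ge0 => //.
  by rewrite fineK// ge0_fin_numE.
have [c1 H1] := HE 1; have [c2 H2] := HE (-1).
apply: (has_mean_dominated _ _ (has_meanZ 2 (has_meanD H1 H2))).
  exact: measurable_funX.
by move=> w; rewrite ger0_norm ?sqr_ge0// mul1r mulN1r sqr_le_expR.
Qed.

Lemma overlap_diag {R : realType} N (s : configuration N) : (0 < N)%N ->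
  overlap R s s = 1.
Proof.
move=> N0; rewrite /overlap (eq_bigr (fun=> 1)) => [|i _].
  by rewrite sumr_const card_ord mulVf// pnatr_eq0 -lt0n.
by rewrite /spin; case: (s i); rewrite ?mulrNN mulr1.
Qed.

Theorem corollary4 (R : realType) (d : measure_display)
    (Omega : measurableType d) (P : probability Omega R)
    (X : forall N : nat, configuration N -> {RV P >-> R})
    (h : nat -> {RV P >-> R})
    (X_indep : forall N : nat, (0 < N)%N ->
      mutually_independent P (fun s : configuration N => X N s : Omega -> R))
    (* [normal_prob] takes the standard deviation; at N = 0 it would be given 0 *)
    (X_gauss : forall (N : nat) (s : configuration N), (0 < N)%N ->
      forall A : set R, measurable A ->
        distribution P (X N s) A = normal_prob 0 (Num.sqrt N%:R) A)
    (h_indep : mutually_independent P (fun i : nat => h i : Omega -> R))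
    (h_ident : forall (i : nat) (A : set R), measurable A ->
      distribution P (h i) A = distribution P (h 0%N) A)
    (h_expmoments : forall t : R, ('M_P (h 0%N) t < +oo)%E)
    (hX_indep : independent_families P
      [set: nat] (fun i : nat => h i : Omega -> R)
      [set p : {N : nat & configuration N} | (0 < tag p)%N]
      (fun p : {N : nat & configuration N} =>
         X (tag p) (tagged p) : Omega -> R))
    (beta_c : R)
    (beta_cE : beta_c = Num.sqrt (2 * (ln 2 -
      (beta_c * fine 'E_P[fun w => h 0%N w * tanh (beta_c * h 0%N w)]
       - fine 'E_P[fun w => ln (cosh (beta_c * h 0%N w))]))))
    (beta : R) (lt_beta : beta_c < beta) :
  let q : R := fine 'E_P[fun w => tanh (beta_c * h 0%N w) ^+ 2] in
  exists mu : probability (measurableTypeR R) R,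
    (forall A : set (measurableTypeR R), measurable A ->
       mu A = ((beta_c / beta)%:E * \d_q A +
               (1 - beta_c / beta)%:E * \d_(1%R : R) A)%E) /\
    weak_cvg_on `[-1, 1] (fun N => overlap_law X h beta N) mu.
Proof.
move=> q.
have [v2 Hv] := square_integrable_of_mgf h_expmoments.
have H1v := has_meanD (has_mean_cst P 1) Hv.
have absle (x : R) : `|x| <= 1 + x ^+ 2.
  by rewrite -(real_normK (num_real x)); have := sqr_ge0 (`|x| - 1);
    have := normr_ge0 x; nra.
have dominated (f : R -> R) K : measurable_fun setT f ->
    (forall x, `|f x| <= K * (1 + x ^+ 2)) -> exists c, has_mean P (fun w => f (h 0%N w)) c.
  move=> mf fK; apply: (has_mean_dominated _ _ (has_meanZ K H1v)).
    exact: measurableT_comp.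
  by move=> w; exact: fK.
have mean_lc b : exists c, has_mean P (fun w => ln (cosh (b * h 0%N w))) c.
  apply: (@dominated (fun x => ln (cosh (b * x))) `|b|); first exact: measurable_ln_cosh.
  move=> x; rewrite ger0_norm ?ln_cosh_ge0// (le_trans (ln_cosh_le _))//.
  by rewrite normrM ler_wpM2l.
have mean_th b : exists c, has_mean P (fun w => h 0%N w * tanh (b * h 0%N w)) c.
  apply: (@dominated (fun x => x * tanh (b * x)) 1).
    by apply: measurable_funM => //; exact: measurable_tanhM.
  move=> x; rewrite mul1r normrM; apply: le_trans (absle x).
  by rewrite ler_piMr// tanh_le1.
have mean_t2 b : exists c, has_mean P (fun w => tanh (b * h 0%N w) ^+ 2) c.
  apply: (@dominated (fun x => tanh (b * x) ^+ 2) 1).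
    by apply: measurable_funX; exact: measurable_tanhM.
  move=> x; rewrite mul1r ger0_norm ?sqr_ge0// (le_trans (tanh_sqr_le1 _))//.
  by rewrite lerDl sqr_ge0.
have [lam Hlam] := mean_lc beta_c; have [a Ha] := mean_th beta_c.
have [q' Hq] := mean_t2 beta_c.
have qq' : q = q' by rewrite /q (has_mean_expectation Hq).
have {}Hq : has_mean P (fun w => tanh (beta_c * h 0%N w) ^+ 2) q by rewrite qq'.
have ln20 : 0 < ln (2 : R) by rewrite ln_gt0// ltr1n.
have [t0 crit] : 0 < beta_c /\ beta_c ^+ 2 / 2 = ln 2 + lam - beta_c * a.
  move: beta_cE; rewrite (has_mean_expectation Hlam) (has_mean_expectation Ha) => bE.
  have b0 : 0 < beta_c.
    rewrite lt_neqAle [in X in _ && X]bE sqrtr_ge0 andbT; apply/eqP => b0.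
    have lam0 : lam = 0.
      apply: (has_mean_unique Hlam); apply: (has_mean_eq _ (has_mean_cst P 0)) => w.
      have c0 : cosh (0 : R) = 1 by rewrite /cosh oppr0 expR0; field.
      by rewrite -b0 mul0r c0 ln1.
    by move: bE; rewrite -b0 lam0 mul0r !subr0 => /esym/eqP;
      rewrite sqrtr_eq0 leNgt mulr_gt0.
  split=> //; have := b0; rewrite [in X in X -> _]bE sqrtr_gt0 => in0.
  by rewrite [in LHS]bE sqr_sqrtr ?(ltW in0)//; field.
have beta0 : 0 < beta by exact: lt_trans lt_beta.
have q01 : 0 <= q <= 1.
  rewrite (has_mean_le (has_mean_cst P 0) Hq) => [|w]; last exact: sqr_ge0.
  by apply: (has_mean_le Hq (has_mean_cst P 1)) => w; exact: tanh_sqr_le1.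
pose m := beta_c / beta.
have m01 : 0 <= m <= 1.
  by rewrite /m divr_ge0 ?(ltW t0) ?(ltW beta0)//= ler_pdivrMr// mul1r ltW.
exists (two_point_law q 1 m01); split; first by move=> A mA; exact: two_point_lawE.
move=> f cf [K fK].
pose D : set (measurableTypeR R) := `[-1, 1]%classic.
have mD : measurable D by exact: measurable_itv.
have mf : measurable_fun (D : set R) f.
  by apply: subspace_continuous_measurable_fun => //; exact: measurable_itv.
have Dq : D q by rewrite /D/= in_itv/=; move: q01 => /andP[? ->]; rewrite andbT; lra.
have D1 : D 1 by rewrite /D/= in_itv/= lexx andbT; lra.
pose g N (p : configuration N * configuration N) := fine (gibbs2_mean X h beta p).
have g0 N (p : configuration N * configuration N) : 0 <= g N p.
  by rewrite fine_ge0// gibbs2_mean_ge0.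
pose S N := \sum_(p : configuration N * configuration N) g N p * f (overlap R p.1 p.2).
have intN N : (\int[overlap_law X h beta N]_(x in D) (f x)%:E = (S N)%:E)%E.
  pose s1 : configuration N := [ffun=> true].
  apply: (integral_finite_support (s1, s1) (@g0 N) mD _ _ mf fK).
  - by move=> p; have := overlap_itv R p.1 p.2.
  - move=> A mA; rewrite [LHS]overlap_lawE; apply: eq_bigr => p _.
    by rewrite /g fineK// gibbs2_mean_fin_num.
have intmu : (\int[two_point_law q 1 m01]_(x in D) (f x)%:E =
  (m * f q + (1 - m) * f 1)%:E)%E.
  have /andP[m0 m1] := m01.
  rewrite (integral_finite_support (c := fun b : bool => if b then m else 1 - m)
    (x := fun b : bool => if b then q else 1) true _ mD _ _ mf fK).
  - by rewrite big_bool.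
  - by case=> //; rewrite subr_ge0.
  - by case.
  - by move=> A mA; rewrite [LHS]two_point_lawE big_bool.
rewrite [X in _ --> X]intmu.
under eq_fun do rewrite intN.
apply: cvg_EFin; first exact: nearW.
apply/cvgrPdist_le => e e0 /=.
have K0 : 0 <= K by apply: le_trans (fK _ D1).
have [dl dl0 fdl] : exists2 dl, 0 < dl & forall y, D y -> `|y - q| <= dl -> `|f y - f q|
  <= e / 4.
  move: cf => /subspace_continuousP/(_ q Dq)/cvgrPdist_le/(_ (e / 4)).
  rewrite divr_gt0// => /(_ isT).
  rewrite near_withinE => -[r /= r0 Hr].
  exists (r / 2); first by rewrite divr_gt0.
  move=> y Dy yq; rewrite distrC; apply: Hr => //=.
  by rewrite /ball_/= distrC (le_lt_trans yq)// gtr_pMr// invf_lt1// ltr1n.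
have [C HC] := off_diagonal_overlap X_indep X_gauss h_indep h_ident hX_indep t0 lt_beta
  Hlam Ha Hq Hv crit dl0.
(* [K + 1] rather than [K], which may vanish *)
pose ee := beta * e / (8 * (K + 1)).
have K1 : 0 < K + 1 by rewrite ltr_wpDl.
have ee0 : 0 < ee by rewrite divr_gt0 ?mulr_gt0.
have [N1 HN1] := gaussian_energy_density X_indep X_gauss h_indep h_ident hX_indep t0
  lt_beta Hlam Ha Hv crit ee0.
pose N2 := (Num.truncn (8 * K * C / e)).+1.
exists (maxn N1 N2) => // N /=; rewrite geq_max => /andP[NN1 NN2].
have N0 : (0 < N)%N by exact: leq_trans NN2.
have NR : 0 < N%:R :> R by rewrite ltr0n.
have far_le := HC N N0.
pose Dg := \sum_(s : configuration N) g N (s, s).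
have diag : `|Dg - (1 - m)| <= ee / beta.
  have := HN1 N NN1 N0 _ (gaussian_energy_ibp X_indep X_gauss hX_indep t0 lt_beta N0).
  have -> : beta * N%:R * (1 - \sum_(s : configuration N) fine
    (gibbs2_mean X h beta (s, s))) / N%:R - beta_c =
     - beta * (Dg - (1 - m)) by rewrite /m /Dg /g; field; rewrite !gt_eqF.
  rewrite normrM normrN (gtr0_norm beta0) => H.
  by rewrite ler_pdivlMr// mulrC.
have total : \sum_p g N p = 1.
  have Hs : has_mean P (fun w => \sum_(p : configuration N * configuration N)
      gibbs X h beta w p.1 * gibbs X h beta w p.2) (\sum_p g N p).
    by apply: has_mean_sum => p _; exact: has_mean_gibbs2.
  apply: (has_mean_unique Hs); apply: (has_mean_eq _ (has_mean_cst P 1)) => w.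
  by rewrite sum_gibbs2.
pose F (p : configuration N * configuration N) := f (overlap R p.1 p.2) - f q.
have SE : S N - (m * f q + (1 - m) * f 1) =
    (Dg - (1 - m)) * (f 1 - f q) + \sum_(p | p.1 != p.2) g N p * F p.
  have -> : S N = f q + \sum_p g N p * F p.
    rewrite -[f q]mul1r -total mulr_suml -big_split/=.
    by apply: eq_bigr => p _; rewrite /F; ring.
  rewrite (bigID (fun p => p.1 == p.2))/=.
  have -> : \sum_(p : configuration N * configuration N | p.1 == p.2) g N p * F p =
      Dg * (f 1 - f q).
    rewrite big_mkcond -(pair_bigA _ (fun s s' : configuration N =>
      if s == s' then g N (s, s') * F (s, s') else 0))/= mulr_suml.
    apply: eq_bigr => s _; rewrite -big_mkcond (big_pred1 s) => [|s'];
      last by rewrite eq_sym.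
    by rewrite /F/= overlap_diag.
  ring.
have FK p : `|F p| <= 2 * K.
  rewrite (le_trans (ler_normB _ _))// mulr_natl mulr2n lerD ?fK//.
  by have := overlap_itv R p.1 p.2.
rewrite distrC SE (le_trans (ler_normD _ _))//.
have part1 : `|(Dg - (1 - m)) * (f 1 - f q)| <= e / 4.
  have f1q : `|f 1 - f q| <= 2 * K.
    by rewrite (le_trans (ler_normB _ _))// mulr_natl mulr2n lerD ?fK.
  rewrite normrM (le_trans (ler_pM _ _ diag f1q))//.
  have -> : ee / beta * (2 * K) = e / 4 * (K / (K + 1)).
    by rewrite /ee; field; rewrite !gt_eqF.
  by rewrite ler_piMr ?divr_ge0 ?(ltW e0)// ler_pdivrMr// mul1r lerDl.
have part2 : `|\sum_(p | p.1 != p.2) g N p * F p| <= e / 4 + 2 * K * (C / N%:R).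
  rewrite (le_trans (ler_norm_sum _ _ _))//.
  apply: (@le_trans _ _ (\sum_(p : configuration N * configuration N) g N p * (e / 4) +
      2 * K * \sum_(p : configuration N * configuration N |
         (p.1 != p.2) && (dl < `|overlap R p.1 p.2 - q|)) g N p)); last first.
    by rewrite -mulr_suml total mul1r lerD2l ler_wpM2l ?mulr_ge0.
  rewrite mulr_sumr [X in _ <= _ + X]big_mkcond -big_split/= big_mkcond/=.
  apply: ler_sum => p _; have gp := g0 N p.
  have ge4 : 0 <= g N p * (e / 4) by rewrite mulr_ge0// divr_ge0// ltW.
  case: (p.1 != p.2) => /=; last by rewrite addr0.
  rewrite normrM ger0_norm//; case: ltP => far.
    by rewrite [2 * K * _]mulrC -[leLHS]add0r lerD// ler_wpM2l.
  rewrite addr0 ler_wpM2l// fdl//.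
  by have := overlap_itv R p.1 p.2.
have CN : 2 * K * (C / N%:R) <= e / 4.
  rewrite mulrA ler_pdivrMr//.
  have : 8 * K * C / e <= N%:R by rewrite ltW// (lt_le_trans (truncnS_gt _))// ler_nat.
  by rewrite ler_pdivrMr//; lra.
by lra.
Qed.
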